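(* Let $C_{\operatorname{HL},b}$ and $\phi_{\operatorname{HL},b}$ be the sharp Tauberian constant and halo function of the uncentered Hardy–Littlewood maximal operator with respect to Euclidean balls in $\mathbb{R}^n$. Then $\phi_{\operatorname{HL},b}\in C^{1/(n+1)}([0,\infty))$, $C_{\operatorname{HL},b}\in C^{1/n}(0,1)$, and $\phi_{\operatorname{HL},b}\in C^{1/n}(1,\infty)$.
   Context: $M_{\operatorname{HL},b}f(x)=\sup_{x\in B}\frac1{|B|}\int_B|f|$, supremum over all Euclidean balls containing $x$. $C_{\operatorname{HL},b}(\alpha)=\sup_{E:\,0<|E|<\infty}\frac{1}{|E|}|\{x:M_{\operatorname{HL},b}\chi_E(x)>\alpha\}|$ for $\alpha\in(0,1)$; $\phi_{\operatorname{HL},b}(\alpha)=C_{\operatorname{HL},b}(1/\alpha)$ for $\alpha>1$ and $\phi_{\operatorname{HL},b}(\alpha)=\alpha$ for $\alpha\in[0,1]$. For an interval $I$, $f\in C^p(I)$ means: for every compact $K\subset I$ there is $C_K$ with $|f(x)-f(y)|\le C_K|x-y|^p$ for all $x,y\in K$. *)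

(* Defs.v *)
From HB Require Import structures.
From mathcomp Require Import all_boot all_order all_algebra.
From mathcomp Require Import all_classical all_reals all_analysis.
Set Implicit Arguments. Unset Strict Implicit. Unset Printing Implicit Defensive.
Import Order.TTheory GRing.Theory Num.Theory.
Import numFieldNormedType.Exports.
Local Open Scope classical_set_scope.
Local Open Scope ring_scope.

Definition hr_box (R : realType) (n : nat) (a b : 'rV[R]_n) : set 'rV[R]_n :=
  [set x | forall i : 'I_n, a ord0 i <= x ord0 i < b ord0 i].

Definition box_vol (R : realType) (n : nat) (a b : 'rV[R]_n) : R :=
  \prod_(i < n) Num.max (b ord0 i - a ord0 i) 0.

Definition leb_outer (R : realType) (n : nat) (A : set 'rV[R]_n) : \bar R :=
  ereal_inf [set s : \bar R | exists a b : nat -> 'rV[R]_n,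
      A `<=` \bigcup_k hr_box (a k) (b k) /\
      s = (\sum_(k <oo) (box_vol (a k) (b k))%:E)%E].

Definition leb_measurable (R : realType) (n : nat) (A : set 'rV[R]_n) : Prop :=
  caratheodory_measurable (@leb_outer R n) A.

Definition eball (R : realType) (n : nat) (c : 'rV[R]_n) (r : R) : set 'rV[R]_n :=
  [set y | Num.sqrt (\sum_(i < n) (y ord0 i - c ord0 i) ^+ 2) < r].

(* Uncentered Hardy-Littlewood maximal function (Euclidean balls) of chi_E:
   M chi_E (x) = sup_{x in B} (1/|B|) int_B chi_E = sup_{x in B} |E cap B| / |B| *)
Definition M_HL_b_chi (R : realType) (n : nat) (E : set 'rV[R]_n)
    (x : 'rV[R]_n) : \bar R :=
  ereal_sup [set v : \bar R | exists (c : 'rV[R]_n) (r : R),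
      0 < r /\ eball c r x /\
      v = (leb_outer (E `&` eball c r) *
           ((fine (leb_outer (eball c r)))^-1)%:E)%E].

Definition C_HL_b (R : realType) (n : nat) (alpha : R) : \bar R :=
  ereal_sup [set v : \bar R | exists E : set 'rV[R]_n,
      [/\ leb_measurable E, (0 < leb_outer E)%E, (leb_outer E < +oo)%E &
      v = (leb_outer [set x | (alpha%:E < M_HL_b_chi E x)%E] *
           ((fine (leb_outer E))^-1)%:E)%E]].

(* Halo function: phi(a) = C(1/a) for a > 1, phi(a) = a for a in [0,1]
   (the value for a < 0 is irrelevant). *)
Definition phi_HL_b (R : realType) (n : nat) (a : R) : R :=
  if a <= 1 then a else fine (C_HL_b n a^-1).

Definition holder_on (R : realType) (p : R) (I : set R) (f : R -> R) : Prop :=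
  forall K : set R, compact K -> K `<=` I ->
    exists CK : R, forall x y, K x -> K y ->
      `|f x - f y| <= CK * powR `|x - y| p.

(* Main.v *)
(* Write C for the Tauberian constant [C_HL_b] and |.| for Lebesgue measure.

   Away from 1, C is even locally Lipschitz.  Let b < a < 1, let E be open and
   let U be a finite union of balls B with |E cap B| > b |B|.  Put mass of
   density t = (a - b) / (1 - b) on U \ E: every B now has average > a, and the
   mass added is t |U \ E| <= t (C(b) - 1) |E|.  On finitely many balls such a
   density is realised by an honest subset of U \ E, hence
     C(b) <= C(a) (1 + t (C(b) - 1)).

   Near 1, one needs the Solyanik estimate C(1 - e^(n+1)) - 1 = O(e).  Let
   |B \ E| <= e^(n+1) |B| for finitely many balls B.  Dilating all balls of a
   finite union by a factor l about their centres multiplies the measure of the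
   union by at most l^n, so shrinking them by 1 - e loses only a factor
   1 + O(e).  The shrunken balls are covered by dyadic cells of side comparable
   to e r(B) inside B; on each of them E misses a proportion O(e), and by
   nestedness of dyadic cells the same holds on their union.

   In the global Holder bound the factor C(b) - 1 of the first estimate absorbs
   the singular denominator 1 - b. *)
Require Import Defs.
From HB Require Import structures.
From mathcomp Require Import all_boot all_order all_algebra.
From mathcomp Require Import all_classical all_reals all_analysis.
From mathcomp Require Import measurable_realfun ring lra.
Set Implicit Arguments. Unset Strict Implicit. Unset Printing Implicit Defensive.
Set SsrOldRewriteGoalsOrder.
Import Order.TTheory GRing.Theory Num.Theory.
Import numFieldNormedType.Exports.
Local Open Scope classical_set_scope.
Local Open Scope ring_scope.

(** * Lebesgue outer measure of boxes *)

Section box_volume.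
Context {R : realType}.

Lemma box_vol_ge0 n (a b : 'rV[R]_n) : 0 <= box_vol a b.
Proof. by apply: prodr_ge0 => i _; rewrite le_max lexx orbT. Qed.

Let clen (a b : R) : R := Num.max (b - a) 0.

Let lebesgue_measure_co (a b : R) :
  lebesgue_measure (`[a, b[%classic : set R) = (clen a b)%:E.
Proof.
rewrite lebesgue_measure_itv /= lte_fin /clen; case: ifPn => [ab|].
  by rewrite max_l ?EFinB ?subr_ge0 ?ltW.
by rewrite -leNgt => ba; rewrite max_r// subr_le0.
Qed.

(** Interpolates between the indicator of the box at [x] ([m = n]) and the volume of the box
    ([m = 0]); integrating out coordinate [m] lowers the index from [m.+1] to [m]. *)
Let mixed n (m : nat) (a b x : 'I_n -> R) : R :=
  \prod_(i < n) (if (i < m)%N then \1_(`[a i, b i[%classic) (x i) else clen (a i) (b i)).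

Let mixed_ge0 n m (a b x : 'I_n -> R) : 0 <= mixed m a b x.
Proof. by apply: prodr_ge0 => i _; case: ifP => // _; rewrite le_max lexx orbT. Qed.

Let mixed_upd n m (mn : (m < n)%N) (a b x : 'I_n -> R) (y : R) :
  mixed m.+1 a b (fun i => if i == Ordinal mn then y else x i) =
  (\prod_(i < n | i != Ordinal mn) (if (i < m)%N then \1_(`[a i, b i[%classic) (x i)
     else clen (a i) (b i)))
  * \1_(`[a (Ordinal mn), b (Ordinal mn)[%classic) y.
Proof.
rewrite /mixed (bigD1 (Ordinal mn))//= ltnSn eqxx mulrC; congr (_ * _).
apply: eq_bigr => i im; rewrite (negbTE im).
have -> // : (i < m.+1)%N = (i < m)%N.
by rewrite ltnS leq_eqVlt; case: eqP => // im'; case/eqP: im; exact: val_inj.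
Qed.

Let mixedE n m (mn : (m < n)%N) (a b x : 'I_n -> R) :
  mixed m a b x =
  (\prod_(i < n | i != Ordinal mn) (if (i < m)%N then \1_(`[a i, b i[%classic) (x i)
     else clen (a i) (b i))) * clen (a (Ordinal mn)) (b (Ordinal mn)).
Proof. by rewrite /mixed (bigD1 (Ordinal mn))//= ltnn mulrC. Qed.

Let integral_mixed n m (mn : (m < n)%N) (a b x : 'I_n -> R) :
  (\int[lebesgue_measure]_(y in setT)
    (mixed m.+1 a b (fun i => if i == Ordinal mn then y else x i))%:E)%E
  = (mixed m a b x)%:E.
Proof.
under eq_integral do rewrite mixed_upd.
rewrite mixedE; set w := \prod_(_ | _) _.
have w0 : 0 <= w.
  by apply: prodr_ge0 => i _; case: ifP => // _; rewrite le_max lexx orbT.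
under eq_integral do rewrite EFinM.
rewrite ge0_integralZl//; last first.
  by apply/measurable_EFinP; exact: measurable_indic.
rewrite integral_indic// setIT EFinM; congr (_ * _)%E.
exact: lebesgue_measure_co.
Qed.

(* Integrating the indicator inequality in one coordinate at a time replaces
   the factors [\1_[a_i, b_i[] by the lengths [b_i - a_i]. *)
Lemma box_vol_subadditive n (a b : 'rV[R]_n) (u v : nat -> 'rV[R]_n) :
  hr_box a b `<=` \bigcup_k hr_box (u k) (v k) ->
  ((box_vol a b)%:E <= \sum_(k <oo) (box_vol (u k) (v k))%:E)%E.
Proof.
move=> sub.
pose c (w : 'rV[R]_n) (i : 'I_n) := w ord0 i.
(* Here [m] counts the coordinates already integrated, starting from the last one. Once all are
   integrated the point no longer matters, so 0 will do. *)
suff H m : (m <= n)%N -> forall x : 'I_n -> R,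
    ((mixed (n - m) (c a) (c b) x)%:E <=
     \sum_(k <oo) (mixed (n - m) (c (u k)) (c (v k)) x)%:E)%E.
  have := H n (leqnn n) (fun=> 0); rewrite subnn.
  by move=> /le_trans; apply; apply: lee_nneseries => k *; rewrite lee_fin.
elim: m => [_ x|m IH mn x].
  rewrite subn0.
  have mix1 (e f : 'rV[R]_n) : mixed n (c e) (c f) x = \1_(hr_box e f) (\row_i x i).
    rewrite /mixed indicE; have [/set_mem h|/negP h] := boolP (_ \in _).
      rewrite big1// => i _; rewrite ltn_ord indicE mem_set//=.
      by have := h i; rewrite mxE in_itv.
    have [i hi] : exists i, ~ (e ord0 i <= x i < f ord0 i).
      apply/not_existsP => h'; apply: h; apply/mem_set => i; rewrite mxE.
      by apply: contrapT => /h'.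
    rewrite (bigD1 i)//= ltn_ord indicE memNset ?mul0r//=.
  rewrite mix1 indicE; have [/set_mem/sub [k _ hk]|_] := boolP (_ \in _); last first.
    by apply: nneseries_ge0 => k _ _; rewrite lee_fin.
  rewrite (@nneseriesD1 _ _ k)//; first last.
  - by move=> i _; rewrite lee_fin.
  rewrite mix1 indicE mem_set// leeDl//.
  by apply: nneseries_ge0 => i _ _; rewrite lee_fin.
have nm : (n - m.+1 < n)%N by rewrite ltn_subrL (leq_trans _ mn).
rewrite -(integral_mixed nm).
under eq_eseriesr do rewrite -(integral_mixed nm).
have mmix e f : measurable_fun [set: R] (fun y => (mixed (n - m.+1).+1 (c e) (c f)
    (fun i => if i == Ordinal nm then y else x i))%:E).
  under eq_fun do rewrite mixed_upd.
  by apply/measurable_EFinP; apply: measurable_funM => //; exact: measurable_indic.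
rewrite -integral_nneseries//; last 2 first.
- by move=> k; exact: mmix.
- by move=> k y _; rewrite lee_fin.
apply: ge0_le_integral => //.
- by move=> y _; rewrite lee_fin.
- exact: mmix.
- by apply: ge0_emeasurable_sum => [k y _ _|k _]; [rewrite lee_fin|exact: mmix].
- by move=> y _; have := IH (ltnW mn) (fun i => if i == Ordinal nm then y else x i);
    rewrite subnSK.
Qed.

End box_volume.

(** * Lebesgue outer measure and Caratheodory measurability of half-spaces *)

Section outer_measure.
Context {R : realType} {n : nat}.
Notation V := 'rV[R]_n.+1.
Implicit Types (A : set V) (a b : V).
Local Open Scope ereal_scope.

(** Positive dimension matters here: an empty product would give volume 1. Degenerate boxes pad a
    finite cover to a countable one. *)
Lemma box_vol_id a : box_vol a a = 0%R.
Proof. by rewrite /box_vol big_ord_recl subrr maxxx mul0r. Qed.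

Lemma leb_outer_ge0 A : 0 <= leb_outer A.
Proof.
apply: le_ereal_inf_tmp => _ [a [b [_ ->]]].
by apply: nneseries_ge0 => k _ _; rewrite lee_fin box_vol_ge0.
Qed.

Lemma le_leb_outer : {homo @leb_outer R n.+1 : A B / A `<=` B >-> A <= B}.
Proof.
move=> A B AB; apply: ereal_inf_le_tmp => _ [a [b [Bab ->]]].
by exists a, b; split => //; exact: subset_trans Bab.
Qed.

Lemma leb_outer_le_cover A (a b : nat -> V) :
  A `<=` \bigcup_k hr_box (a k) (b k) ->
  leb_outer A <= \sum_(k <oo) (box_vol (a k) (b k))%:E.
Proof. by move=> Aab; apply: ereal_inf_lbound; exists a, b. Qed.

Lemma leb_outer_box a b : leb_outer (hr_box a b) = (box_vol a b)%:E.
Proof.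
apply/eqP; rewrite eq_le; apply/andP; split.
  pose u k := if k is 0%N then a else b; pose v (k : nat) := b.
  have := @leb_outer_le_cover (hr_box a b) u v.
  rewrite (@nneseriesD1 _ _ 0%N)//; last by move=> k _; rewrite lee_fin box_vol_ge0.
  rewrite eseries0 ?adde0; last by move=> [|k]// _ _; rewrite box_vol_id.
  by apply; move=> x abx; exists 0%N.
apply: le_ereal_inf_tmp => _ [u [v [ab ->]]].
exact: box_vol_subadditive.
Qed.

Lemma leb_outer0 : leb_outer (set0 : set V) = 0.
Proof.
apply/eqP; rewrite eq_le leb_outer_ge0 andbT.
by rewrite (le_trans (le_leb_outer (@sub0set _ (hr_box 0%R 0%R))))// leb_outer_box box_vol_id.
Qed.

Lemma leb_outer_sigma_subadditive : sigma_subadditive (@leb_outer R n.+1).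
Proof.
move=> F; have [[i ioo]|] := pselect (exists i, leb_outer (F i) = +oo).
  rewrite (eseries_pinfty _ _ ioo) ?leey// => k _.
  by rewrite -ltNye (lt_le_trans _ (leb_outer_ge0 _)).
rewrite -forallNE => Foo.
apply/lee_addgt0Pr => e e0.
rewrite (le_trans _ (epsilon_trick _ _ _))//; [|by move=> k; exact: leb_outer_ge0|exact: ltW].
pose P i (ab : (nat -> V) * (nat -> V)) :=
  F i `<=` \bigcup_k hr_box (ab.1 k) (ab.2 k) /\
  \sum_(k <oo) (box_vol (ab.1 k) (ab.2 k))%:E <= leb_outer (F i) + (e / (2 ^ i.+1)%:R)%:E.
have /choice[G PG] : forall i, exists ab, P i ab.
  move=> i; have e2 : (0 < e / (2 ^ i.+1)%:R)%R by rewrite divr_gt0// ltr0n expn_gt0.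
  have fini : leb_outer (F i) \is a fin_num.
    by rewrite ge0_fin_numE ?leb_outer_ge0// ltey; apply/eqP/Foo.
  have [_ [a [b [Fab ->]]] h] := lb_ereal_inf_adherent e2 fini.
  by exists (a, b); split => //=; exact: ltW.
(* A bijection between [nat] and [nat * nat] merges the covers of all the [F i] into a single
   sequence of boxes. *)
have /card_esym/ppcard_eqP[f] := card_nat2.
pose vol (p : nat * nat) := (box_vol ((G p.1).1 p.2) ((G p.1).2 p.2))%:E.
have vol0 p : 0 <= vol p by rewrite lee_fin box_vol_ge0.
apply: (@le_trans _ _ (\sum_(k <oo) vol (f k))).
  apply: leb_outer_le_cover => x [i _ /(PG i).1 [j _ Fx]].
  by exists (f^-1%FUN (i, j)) => //; rewrite invK ?inE.
rewrite nneseries_esum// fun_true -(@reindex_esum _ _ _ _ setT)//.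
rewrite [leLHS](_ : _ = \sum_(i <oo) \sum_(j <oo) vol (i, j)); last first.
  rewrite nneseries_esum ?fun_true; last by move=> i _; exact: nneseries_ge0.
  under [RHS]eq_esum do rewrite nneseries_esum// fun_true.
  rewrite esum_esum// (_ : _ `*`` _ = setT); first by apply: eq_esum => -[].
  by apply/seteqP; split.
apply: lee_nneseries => [i _ _|i _]; first exact: nneseries_ge0.
exact: (PG i).2.
Qed.

HB.instance Definition _ := isOuterMeasure.Build R V (@leb_outer R n.+1)
  leb_outer0 leb_outer_ge0 le_leb_outer leb_outer_sigma_subadditive.

Lemma leb_outerU A B : leb_outer (A `|` B) <= leb_outer A + leb_outer B.
Proof. exact: outer_measureU2. Qed.

(** Any test set can be replaced by the boxes of a cover: splitting each box along [A] splits the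
    test set, and the costs add up by subadditivity. *)
Lemma leb_measurable_of_boxes A :
  (forall a b, leb_outer (hr_box a b `&` A) + leb_outer (hr_box a b `&` ~` A) <=
     (box_vol a b)%:E) -> leb_measurable A.
Proof.
move=> boxA; apply: (@le_caratheodory_measurable _ _ (@leb_outer R n.+1)) => X.
apply: le_ereal_inf_tmp => _ [a [b [Xab ->]]].
apply: (@le_trans _ _ (\sum_(k <oo) (leb_outer (hr_box (a k) (b k) `&` A) +
    leb_outer (hr_box (a k) (b k) `&` ~` A)))).
  rewrite nneseriesD; [|by move=> *; exact: leb_outer_ge0|by move=> *; exact: leb_outer_ge0].
  apply: leeD.
  - apply: le_trans (leb_outer_sigma_subadditive _); apply: le_leb_outer.
    by rewrite -setI_bigcupl; exact: setSI.
  - apply: le_trans (leb_outer_sigma_subadditive _); apply: le_leb_outer.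
    by rewrite -setI_bigcupl; exact: setSI.
by apply: lee_nneseries => k *; [rewrite adde_ge0// leb_outer_ge0|exact: boxA].
Qed.

Lemma leb_measurable_halfspace (i : 'I_n.+1) (s : R) :
  leb_measurable [set x : V | (x ord0 i < s)%R].
Proof.
apply: leb_measurable_of_boxes => a b.
(* The hyperplane cuts the box in two: [lo] is the upper corner of the lower piece, [hi] the lower
   corner of the upper piece. *)
pose lo : V := \row_j (if j == i then Num.min (b ord0 i) s else b ord0 j)%R.
pose hi : V := \row_j (if j == i then Num.max (a ord0 i) s else a ord0 j)%R.
apply: (@le_trans _ _ (leb_outer (hr_box a lo) + leb_outer (hr_box hi b))).
  apply: leeD; apply: le_leb_outer.
  - move=> x [abx /= xs] j; rewrite mxE; case: eqP => [->|_]; last exact: abx.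
    by have /andP[-> h] := abx i; rewrite lt_min h.
  - move=> x [abx /= xs] j; rewrite mxE; case: eqP => [->|_]; last exact: abx.
    have /andP[h ->] := abx i; rewrite andbT ge_max h/=.
    by rewrite leNgt; apply/negP.
rewrite !leb_outer_box -EFinD lee_fin /box_vol.
rewrite (bigD1 i)//= [X in (_ + X)%R](bigD1 i)//= [X in (_ <= X)%R](bigD1 i)//=.
rewrite !mxE eqxx.
rewrite [X in (_ * X + _)%R](eq_bigr (fun j => Num.max (b ord0 j - a ord0 j) 0)%R); last first.
  by move=> j /negbTE ji; rewrite mxE ji.
rewrite [X in (_ + _ * X)%R](eq_bigr (fun j => Num.max (b ord0 j - a ord0 j) 0)%R); last first.
  by move=> j /negbTE ji; rewrite mxE ji.
rewrite -mulrDl; apply: ler_wpM2r.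
  by apply: prodr_ge0 => j _; rewrite le_max lexx orbT.
move: (a ord0 i) (b ord0 i) => {lo hi}p q.
rewrite !maxEle !minEle.
case: (leP q s) => ?; case: (leP p s) => ?; repeat case: ifPn; rewrite -?ltNge => *; lra.
Qed.

End outer_measure.

(** * Euclidean balls and open sets *)

Section euclidean.
Context {R : realType} {n : nat}.
Notation V := 'rV[R]_n.+1.
Implicit Types (u v x y c : V) (r s : R).

(** The squared Euclidean norm; with squares, ball inequalities stay polynomial. *)
Definition esq u : R := \sum_(i < n.+1) u ord0 i ^+ 2.

Lemma esq_ge0 u : 0 <= esq u.
Proof. by apply: sumr_ge0 => i _; exact: sqr_ge0. Qed.

Lemma esqZ r u : esq (r *: u) = r ^+ 2 * esq u.
Proof. by rewrite /esq mulr_sumr; apply: eq_bigr => i _; rewrite mxE exprMn. Qed.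

Lemma esqN u : esq (- u) = esq u.
Proof. by rewrite -scaleN1r esqZ sqrrN expr1n mul1r. Qed.

Lemma eballE c r x : 0 < r -> eball c r x <-> esq (x - c) < r ^+ 2.
Proof.
move=> r0; rewrite /eball /=.
have -> : \sum_(i < n.+1) (x ord0 i - c ord0 i) ^+ 2 = esq (x - c).
  by apply: eq_bigr => i _; rewrite !mxE.
by rewrite -ltr_sqr ?nnegrE ?sqrtr_ge0 ?(ltW r0)// sqr_sqrtr// esq_ge0.
Qed.

Lemma esqD_lt u v r s : 0 < r -> 0 < s -> esq u < r ^+ 2 -> esq v <= s ^+ 2 ->
  esq (u + v) < (r + s) ^+ 2.
Proof.
move=> r0 s0 ur vs.
pose d := \sum_(i < n.+1) u ord0 i * v ord0 i.
have -> : esq (u + v) = esq u + 2 * d + esq v.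
  rewrite /esq /d mulr_sumr -!big_split/=; apply: eq_bigr => i _.
  by rewrite mxE; ring.
(* The right side is |s u - r v|^2. Its positivity plays the part of Cauchy-Schwarz and gives
   [d <= r * s] after division by [2 * (r * s)]. *)
have : 0 <= s ^+ 2 * esq u - 2 * (r * s) * d + r ^+ 2 * esq v.
  rewrite /esq /d !mulr_sumr -sumrB -big_split/=; apply: sumr_ge0 => i _.
  by rewrite [leRHS](_ : _ = (s * u ord0 i - r * v ord0 i) ^+ 2) ?sqr_ge0//; ring.
move=> h.
have drs : d <= r * s.
  rewrite -(@ler_pM2l _ (2 * (r * s))) ?mulr_gt0//.
  have h1 : s ^+ 2 * esq u <= s ^+ 2 * r ^+ 2 by rewrite ler_wpM2l ?sqr_ge0// ltW.
  have h2 : r ^+ 2 * esq v <= r ^+ 2 * s ^+ 2 by rewrite ler_wpM2l ?sqr_ge0.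
  nra.
nra.
Qed.

Lemma eballD c r s x y : 0 < r -> 0 < s -> eball c r x -> esq (y - x) <= s ^+ 2 ->
  eball c (r + s) y.
Proof.
move=> r0 s0 /(eballE _ _ r0) cx xy; apply/eballE; first exact: addr_gt0.
by have -> : y - c = (x - c) + (y - x); [rewrite [RHS]addrC addrA subrK|exact: esqD_lt].
Qed.

Definition eopen (G : set V) := forall x, G x -> exists2 r, 0 < r & eball x r `<=` G.

Lemma eopen_eball c r : 0 < r -> eopen (eball c r).
Proof.
move=> r0 x cx; pose q := (Num.sqrt (esq (x - c)) + r) / 2.
have hs : Num.sqrt (esq (x - c)) < r.
  move: cx => /(eballE _ _ r0).
  by rewrite -{2}(gtr0_norm r0) -sqrtr_sqr -ltr_sqrt ?exprn_gt0.
have hs0 := sqrtr_ge0 (esq (x - c)).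
have q0 : 0 < q by rewrite /q; lra.
have rq : 0 < r - q by rewrite /q; lra.
exists (r - q) => // y /(eballE _ _ rq) /ltW xy.
rewrite -(subrKC q r); apply: (eballD q0 rq _ xy); apply/eballE => //.
rewrite -(sqr_sqrtr (esq_ge0 _)) ltr_sqr ?nnegrE//; last exact: ltW.
by rewrite /q; lra.
Qed.

Lemma eball_center c r : 0 < r -> eball c r c.
Proof.
move=> r0; apply/eballE => //; rewrite subrr.
have -> : esq (0 : V) = 0 by rewrite -(scale0r (0 : V)) esqZ expr0n mul0r.
exact: exprn_gt0.
Qed.

Lemma eopen_bigcup (I : Type) (D : set I) (F : I -> set V) :
  (forall i, D i -> eopen (F i)) -> eopen (\bigcup_(i in D) F i).
Proof.
move=> oF x [i Di Fx]; have [r r0 h] := oF i Di x Fx.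
by exists r => // y /h ?; exists i.
Qed.

(** A crude bound: the dimension stands in for its square root. *)
Lemma esq_coord_le u r : 0 <= r -> (forall i, `|u ord0 i| <= r) ->
  esq u <= (n.+1%:R * r) ^+ 2.
Proof.
move=> r0 ur; apply: (@le_trans _ _ (\sum_(i < n.+1) r ^+ 2)).
  by apply: ler_sum => i _; rewrite -(real_normK (num_real (u ord0 i))) ler_sqr ?nnegrE.
rewrite sumr_const card_ord -(mulr_natl (r ^+ 2)) exprMn; apply: ler_wpM2r; first exact: sqr_ge0.
by rewrite -natrX ler_nat; exact: leq_pmulr.
Qed.

Lemma coord_lt_eball c r x i : 0 < r -> eball c r x -> `|x ord0 i - c ord0 i| < r.
Proof.
move=> r0 /(eballE _ _ r0) h; rewrite -ltr_sqr ?nnegrE ?(ltW r0)// real_normK ?num_real//.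
apply: le_lt_trans h; rewrite /esq (bigD1 i)//= !mxE lerDl.
by apply: sumr_ge0 => j _; exact: sqr_ge0.
Qed.

(** Serves to compare two power distances, whose difference is affine. *)
Lemma eopen_halfspace (w : V) (t : R) :
  eopen [set x | \sum_(i < n.+1) w ord0 i * x ord0 i < t].
Proof.
move=> x /= xt.
pose W := 1 + \sum_(i < n.+1) `|w ord0 i|.
have W0 : 0 < W by rewrite ltr_wpDr// sumr_ge0.
pose d := (t - \sum_(i < n.+1) w ord0 i * x ord0 i) / W.
have d0 : 0 < d by rewrite divr_gt0// subr_gt0.
exists d => // y xy /=.
have : \sum_(i < n.+1) w ord0 i * y ord0 i - \sum_(i < n.+1) w ord0 i * x ord0 i <=
    (W - 1) * d.
  rewrite -sumrB /W addrC addKr mulr_suml; apply: ler_sum => i _.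
  rewrite -mulrBr (le_trans (ler_norm _))// normrM ler_wpM2l//.
  by rewrite ltW// coord_lt_eball.
have : W * d = t - \sum_(i < n.+1) w ord0 i * x ord0 i by rewrite mulrC divfK ?gt_eqF.
by rewrite mulrBl mul1r; lra.
Qed.

End euclidean.

(** * Measurable sets and volume *)

Lemma outer_measure_bigcup_le (R : realType) (T : pointedType)
    (mu : {outer_measure set T -> \bar R}) (F : nat -> set T) (K : \bar R) :
  (forall k, caratheodory_measurable mu (F k)) -> (forall k, F k `<=` F k.+1) ->
  (forall k, (mu (F k) <= K)%E) -> (mu (\bigcup_k F k) <= K)%E.
Proof.
move=> mF ndF FK.
have := @nondecreasing_cvg_mu _ (caratheodory_type mu) R mu F mF
  (caratheodory_measurable_bigcup mF).
move=> /(_ _)/cvg_lim <-//; last first.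
  apply/nondecreasing_seqP => k; exact/subsetPset.
apply: lime_le; last by apply: nearW => k; exact: FK.
apply: ereal_nondecreasing_is_cvgn; apply/nondecreasing_seqP => k.
exact: le_outer_measure.
Qed.

Section measurable_sets.
Context {R : realType} {n : nat}.
Notation V := 'rV[R]_n.+1.
Implicit Types (A B E G X : set V) (c x y : V) (r s : R) (l m : seq (V * R)).

Lemma leb_measurable0 : leb_measurable (set0 : set V).
Proof. exact: (@caratheodory_measurable_set0 _ _ (@leb_outer R n.+1)). Qed.

Lemma leb_measurableC A : leb_measurable A -> leb_measurable (~` A).
Proof. exact: (@caratheodory_measurable_setC _ _ (@leb_outer R n.+1)). Qed.

Lemma leb_measurableU A B : leb_measurable A -> leb_measurable B ->
  leb_measurable (A `|` B).
Proof. exact: (@caratheodory_measurable_setU _ _ (@leb_outer R n.+1)). Qed.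

Lemma leb_measurableI A B : leb_measurable A -> leb_measurable B ->
  leb_measurable (A `&` B).
Proof. exact: (@caratheodory_measurable_setI _ _ (@leb_outer R n.+1)). Qed.

Lemma leb_measurableD A B : leb_measurable A -> leb_measurable B ->
  leb_measurable (A `\` B).
Proof. exact: (@caratheodory_measurable_setD _ _ (@leb_outer R n.+1)). Qed.

Lemma leb_measurable_bigcup (F : nat -> set V) : (forall k, leb_measurable (F k)) ->
  leb_measurable (\bigcup_k F k).
Proof. exact: (@caratheodory_measurable_bigcup _ _ (@leb_outer R n.+1)). Qed.

Lemma leb_measurable_countable (I : countType) (F : I -> set V) :
  (forall i, leb_measurable (F i)) -> leb_measurable (\bigcup_i F i).
Proof.
move=> mF.
have -> : \bigcup_i F i =
    \bigcup_k (if unpickle k is Some i then F i else set0).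
  apply/seteqP; split => [x [i _ Fx]|x [k _]].
    by exists (pickle i) => //; rewrite pickleK.
  by case: unpickle => // i Fx; exists i.
by apply: leb_measurable_bigcup => k; case: unpickle => // *; exact: leb_measurable0.
Qed.

Lemma leb_outer_bigcup_le (F : nat -> set V) (K : \bar R) :
  (forall k, leb_measurable (F k)) -> (forall k, F k `<=` F k.+1) ->
  (forall k, (leb_outer (F k) <= K)%E) -> (leb_outer (\bigcup_k F k) <= K)%E.
Proof. exact: (@outer_measure_bigcup_le _ _ (@leb_outer R n.+1)). Qed.

Definition cell s x : 'rV[int]_n.+1 := \row_i Num.floor (x ord0 i / s).

Definition cellset s (z : 'rV[int]_n.+1) : set V := [set x | cell s x = z].

Lemma cellset_box s z : 0 < s ->
  cellset s z = hr_box (\row_i (s * (z ord0 i)%:~R)) (\row_i (s * (z ord0 i)%:~R + s)).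
Proof.
move=> s0; apply/seteqP; split => [x <- i|x xz].
  have /andP[h1 h2] := Num.Theory.floor_itv (x ord0 i / s).
  rewrite !mxE; move: h1 h2; rewrite ler_pdivlMr// ltr_pdivrMr// intrD mulrDl mul1r.
  by rewrite mulrC => -> ->.
apply/rowP => i; rewrite !mxE; apply: Num.Theory.floor_def.
have := xz i; rewrite !mxE.
by rewrite ler_pdivlMr// ltr_pdivrMr// intrD mulrDl mul1r mulrC.
Qed.

Lemma cell_dist s x y i : 0 < s -> cell s x = cell s y ->
  `|x ord0 i - y ord0 i| <= s.
Proof.
move=> s0 xy.
have : cellset s (cell s y) x by [].
have : cellset s (cell s y) y by [].
rewrite cellset_box// => /(_ i); rewrite !mxE => /andP[h1 h2] /(_ i).
rewrite !mxE => /andP[h3 h4].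
by rewrite ler_norml; apply/andP; split; lra.
Qed.

Lemma leb_measurable_box (a b : V) : leb_measurable (hr_box a b).
Proof.
have -> : hr_box a b = ~` (\bigcup_(i : 'I_n.+1) [set x : V | x ord0 i < a ord0 i])
    `&` ~` (\bigcup_(i : 'I_n.+1) ~` [set x : V | x ord0 i < b ord0 i]).
  apply/seteqP; split => [x abx|x [/= h1 h2] i].
    split; move=> [i _] /=; have /andP[h1 h2] := abx i; last by rewrite h2.
    by rewrite ltNge h1.
  apply/andP; split; first by rewrite leNgt; apply/negP => h; apply: h1; exists i.
  by apply: contrapT => h; apply: h2; exists i.
apply: leb_measurableI; apply: leb_measurableC; apply: leb_measurable_countable => i.
  exact: leb_measurable_halfspace.
by apply: leb_measurableC; exact: leb_measurable_halfspace.
Qed.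

Lemma leb_measurable_cellset s z : 0 < s -> leb_measurable (cellset s z).
Proof. by move=> s0; rewrite cellset_box//; exact: leb_measurable_box. Qed.

Lemma leb_outer_cellset s z : 0 < s -> leb_outer (cellset s z) = (s ^+ n.+1)%:E.
Proof.
move=> s0; rewrite cellset_box// leb_outer_box /box_vol; congr EFin.
rewrite (eq_bigr (fun=> s)); first by rewrite prodr_const card_ord.
by move=> i _; rewrite !mxE addrC addKr max_l// ltW.
Qed.

(** The grid cubes of sides [k.+1%:R^-1] are countably many and fine enough to exhaust every open
    set; all countability arguments below rest on this. *)
Lemma cell_sub_eball x r : 0 < r ->
  exists k : nat, cellset k.+1%:R^-1 (cell k.+1%:R^-1 x) `<=` eball x r.
Proof.
move=> r0; pose k := Num.truncn (n.+1%:R / (r / 2) : R).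
have k0 : 0 < (k.+1%:R : R) by [].
have hk : n.+1%:R * k.+1%:R^-1 <= r / 2 :> R.
  rewrite ler_pdivrMr// mulrC -ler_pdivrMr ?divr_gt0// ltW//.
  exact: truncnS_gt.
exists k => y /= yx; apply/eballE => //.
apply: (@le_lt_trans _ _ ((n.+1%:R * k.+1%:R^-1) ^+ 2)).
  apply: esq_coord_le; first by rewrite invr_ge0.
  by move=> i; rewrite !mxE; apply: cell_dist => //; rewrite invr_gt0.
rewrite ltr_sqr ?nnegrE ?mulr_ge0 ?invr_ge0// ?(ltW r0)//.
by apply: le_lt_trans hk _; lra.
Qed.

Lemma leb_measurable_eopen G : eopen G -> leb_measurable G.
Proof.
move=> oG.
have -> : G = \bigcup_(kz : nat * 'rV[int]_n.+1)
    (if pselect (cellset kz.1.+1%:R^-1 kz.2 `<=` G) then cellset kz.1.+1%:R^-1 kz.2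
     else set0).
  apply/seteqP; split => [x Gx|x [[k z] _ /=]]; last first.
    by case: pselect => // h /h.
  have [r r0 rG] := oG x Gx; have [k kx] := cell_sub_eball x r0.
  exists (k, cell k.+1%:R^-1 x) => //=.
  by case: pselect => // -[]; exact: subset_trans rG.
apply: leb_measurable_countable => -[k z]; case: pselect => /= h.
  by apply: leb_measurable_cellset; rewrite invr_gt0.
exact: leb_measurable0.
Qed.

Lemma leb_measurable_eball c r : 0 < r -> leb_measurable (eball c r).
Proof. by move=> r0; apply: leb_measurable_eopen; exact: eopen_eball. Qed.

Definition ballsU (l : seq (V * R)) : set V :=
  \bigcup_(p in [set` l]) eball p.1 p.2.

Lemma ballsU_nil : ballsU [::] = set0.
Proof. by apply/seteqP; split => // x [p]; rewrite /= in_nil. Qed.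

Lemma ballsU_cons p l : ballsU (p :: l) = eball p.1 p.2 `|` ballsU l.
Proof.
apply/seteqP; split => [x [q /=]|x []].
- by rewrite inE => /orP[/eqP ->|qs qx]; [left|right; exists q].
- by move=> px; exists p => //=; rewrite mem_head.
- by move=> [q /= qs qx]; exists q => //=; rewrite inE qs orbT.
Qed.

Lemma ballsU_sub l m : {subset l <= m} -> ballsU l `<=` ballsU m.
Proof. by move=> st x [p /st pt px]; exists p. Qed.

Definition posballs (l : seq (V * R)) := forall p, p \in l -> 0 < p.2.

Lemma eopen_ballsU l : posballs l -> eopen (ballsU l).
Proof. by move=> l0; apply: eopen_bigcup => p /l0; exact: eopen_eball. Qed.

Lemma leb_measurable_ballsU l : posballs l -> leb_measurable (ballsU l).
Proof. by move=> l0; apply: leb_measurable_eopen; exact: eopen_ballsU. Qed.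

(** A Lindelof argument. For each grid cube lying in some ball of [P], one such ball is selected.
    The selected balls are countably many with the same union, which is the increasing limit of
    finite unions. *)
Lemma leb_outer_balls_le (P : set (V * R)) (K : \bar R) :
  (forall p, P p -> 0 < p.2) ->
  (forall l : seq (V * R), (forall p, p \in l -> P p) -> (leb_outer (ballsU l) <= K)%E) ->
  (leb_outer (\bigcup_(p in P) eball p.1 p.2) <= K)%E.
Proof.
move=> P0 PK.
pose W (kz : nat * 'rV[int]_n.+1) (p : V * R) :=
  P p /\ cellset kz.1.+1%:R^-1 kz.2 `<=` eball p.1 p.2.
pose q j : option (V * R) := if unpickle j is Some kz then
  (if pselect (exists p, W kz p) is left h then Some (projT1 (cid h)) else None) else None.
have qP j p : q j = Some p -> P p.
  rewrite /q; case: unpickle => // kz; case: pselect => // h [<-].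
  by case: (cid h) => ? [].
pose F j := ballsU (pmap q (iota 0 j)).
have memq j p : p \in pmap q (iota 0 j) -> P p.
  by rewrite mem_pmap => /mapP[i _ /esym/qP].
apply: (@le_trans _ _ (leb_outer (\bigcup_j F j))).
  apply: le_leb_outer => x [p Pp px].
  have [r r0 rp] := eopen_eball (P0 _ Pp) px; have [k kx] := cell_sub_eball x r0.
  pose kz := (k, cell k.+1%:R^-1 x).
  have hW : exists p, W kz p.
    by exists p; split => //=; exact: subset_trans rp.
  have [p' qp'] : exists2 p', q (pickle kz) = Some p' & W kz p'.
    rewrite /q pickleK; case: pselect => // h.
    by exists (projT1 (cid h)) => //; case: (cid h).
  move=> [Pp' kp']; exists (pickle kz).+1 => //; exists p'; last exact: kp'.
  change (is_true (p' \in pmap q (iota 0 (pickle kz).+1))).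
  rewrite mem_pmap; apply/mapP; exists (pickle kz) => //.
  by rewrite mem_iota leq0n add0n ltnSn.
apply: leb_outer_bigcup_le => j.
- by apply: leb_measurable_ballsU => p /memq; exact: P0.
- by apply: ballsU_sub => p; rewrite -(addn1 j) iotaD pmap_cat mem_cat => ->.
- by apply: PK => p; exact: memq.
Qed.

End measurable_sets.

(** By convexity the power lies below its chord over [0, 1], whose slope [2 ^+ k - 1] is the
    constant that the induction carries. *)
Lemma expr1D_le (R : realFieldType) (d : R) k : 0 <= d <= 1 ->
  (1 + d) ^+ k <= 1 + 2 ^+ k * d.
Proof.
move=> /andP[d0 d1].
suff : (1 + d) ^+ k <= 1 + (2 ^+ k - 1) * d by nra.
elim: k => [|k IH]; first by rewrite !expr0 subrr mul0r addr0.
have h2 : 1 <= 2 ^+ k :> R by rewrite exprn_ege1// ler1n.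
rewrite exprS (le_trans (ler_wpM2l _ IH)) ?addr_ge0// exprS.
have : 0 <= (2 ^+ k - 1) * d * (1 - d) by rewrite !mulr_ge0// subr_ge0.
nra.
Qed.

(** * Real-valued volume, scaling and outer regularity *)

Section volume.
Context {R : realType} {n : nat}.
Notation V := 'rV[R]_n.+1.
Implicit Types (A B E G X : set V) (a b c x y : V) (l r s : R) (m : seq (V * R)).

(** [fine] sends an infinite measure to 0, hence the finiteness hypotheses in the monotonicity and
    additivity lemmas. *)
Definition vol A : R := fine (leb_outer A).

Lemma volE A : (leb_outer A < +oo)%E -> leb_outer A = (vol A)%:E.
Proof. by move=> Aoo; rewrite fineK// ge0_fin_numE// leb_outer_ge0. Qed.

Lemma vol_ge0 A : 0 <= vol A.
Proof. by rewrite fine_ge0// leb_outer_ge0. Qed.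

Lemma leb_sub_lty A B : A `<=` B -> (leb_outer B < +oo)%E -> (leb_outer A < +oo)%E.
Proof. by move=> AB; apply: le_lt_trans; exact: le_leb_outer. Qed.

Lemma lebU_lty A B : (leb_outer A < +oo)%E -> (leb_outer B < +oo)%E ->
  (leb_outer (A `|` B) < +oo)%E.
Proof. by move=> Aoo Boo; rewrite (le_lt_trans (leb_outerU _ _))// lte_add_pinfty. Qed.

Lemma le_vol A B : A `<=` B -> (leb_outer B < +oo)%E -> vol A <= vol B.
Proof.
move=> AB Boo; rewrite -lee_fin -!volE//; first exact: le_leb_outer.
exact: leb_sub_lty Boo.
Qed.

Lemma vol0 : vol set0 = 0.
Proof. by rewrite /vol leb_outer0. Qed.

Lemma vol_split A X : leb_measurable A -> (leb_outer X < +oo)%E ->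
  vol X = vol (X `&` A) + vol (X `\` A).
Proof.
move=> mA Xoo; apply: EFin_inj; rewrite EFinD -!volE//.
- by apply: leb_sub_lty Xoo => x [].
- by apply: leb_sub_lty Xoo => x [].
Qed.

Lemma volU_le A B : (leb_outer A < +oo)%E -> (leb_outer B < +oo)%E ->
  vol (A `|` B) <= vol A + vol B.
Proof.
move=> Aoo Boo; rewrite -lee_fin EFinD -!volE//; [exact: leb_outerU|exact: lebU_lty].
Qed.

Lemma volU A B : leb_measurable A -> A `&` B `<=` set0 ->
  (leb_outer A < +oo)%E -> (leb_outer B < +oo)%E -> vol (A `|` B) = vol A + vol B.
Proof.
move=> mA AB Aoo Boo; rewrite (@vol_split A)//; last exact: lebU_lty.
congr (vol _ + vol _); apply/seteqP; split.
- by move=> x [].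
- by move=> x Ax; split => //; left.
- by move=> x [[]].
- by move=> x Bx; split; [right|move=> Ax; exact: (AB x)].
Qed.

Let leb_outer_affine_le l c A : 0 < l ->
  ((l ^+ n.+1)%:E * leb_outer [set x | A (l *: x + c)%R] <= leb_outer A)%E.
Proof.
move=> l0; have ln0 : 0 < l ^+ n.+1 by rewrite exprn_gt0.
apply: le_ereal_inf_tmp => _ [a [b [Aab ->]]].
pose f (u : V) : V := l^-1 *: (u - c).
have volf k : (box_vol (f (a k)) (f (b k))) = (l ^+ n.+1)^-1 * box_vol (a k) (b k).
  have -> : (l ^+ n.+1)^-1 = \prod_(i < n.+1) l^-1 by rewrite prodr_const card_ord exprVn.
  rewrite /box_vol -big_split/=; apply: eq_bigr => i _.
  rewrite !mxE -mulrBr opprB addrA subrK maxr_pMr ?mulr0//.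
  by rewrite invr_ge0 ltW.
rewrite -lee_pdivlMl//.
have -> : ((l ^+ n.+1)^-1%:E * (\sum_(k <oo) (box_vol (a k) (b k))%:E) =
    \sum_(k <oo) (box_vol (f (a k)) (f (b k)))%:E)%E.
  rewrite -nneseriesZl; last by move=> k _; rewrite lee_fin box_vol_ge0.
  by apply: eq_eseriesr => k _; rewrite -EFinM volf.
apply: leb_outer_le_cover => x /= /Aab [k _ abx]; exists k => // i.
have := abx i; rewrite !mxE => /andP[h1 h2].
rewrite ler_pdivrMl// ltr_pdivlMl//; apply/andP; split; lra.
Qed.

(** One inequality comes from pulling back covers by boxes, the other from applying it to the
    inverse affine map. *)
Lemma leb_outer_affine l c A : 0 < l ->
  leb_outer A = ((l ^+ n.+1)%:E * leb_outer [set x | A (l *: x + c)%R])%E.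
Proof.
move=> l0; apply/eqP; rewrite eq_le leb_outer_affine_le// andbT.
have ln0 : 0 < l ^+ n.+1 by rewrite exprn_gt0.
have li0 : 0 < l^-1 by rewrite invr_gt0.
have := leb_outer_affine_le (- (l^-1 *: c)) [set x | A (l *: x + c)] li0.
have -> : [set x | [set x | A (l *: x + c)] (l^-1 *: x + - (l^-1 *: c))] = A.
  apply/seteqP; split => x /=;
    by rewrite scalerDr scalerN !scalerA mulfV ?gt_eqF// !scale1r subrK.
by rewrite exprVn lee_pdivrMl.
Qed.

Lemma vol_affine l c A : 0 < l -> vol A = l ^+ n.+1 * vol [set x | A (l *: x + c)].
Proof.
move=> l0; rewrite /vol (leb_outer_affine c A l0).
have := leb_outer_ge0 [set x | A (l *: x + c)].
case: (leb_outer [set x | A (l *: x + c)]) => [r _|_|//] /=; first by [].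
(* If the measure is infinite, both sides are 0 by the default value of [fine]. *)
by rewrite gt0_muley ?lte_fin ?exprn_gt0// mulr0.
Qed.

Lemma leb_measurable_affine l c A : 0 < l -> leb_measurable A ->
  leb_measurable [set x | A (l *: x + c)].
Proof.
move=> l0 mA X.
pose Y := [set y | X (l^-1 *: (y - c))].
have XY : X = [set x | Y (l *: x + c)].
  apply/seteqP; split => x /=;
    by rewrite /Y /= addrK scalerA mulVf ?gt_eqF// scale1r.
have ln0 : 0 < l ^+ n.+1 by rewrite exprn_gt0.
have h Z : leb_outer [set x | Z (l *: x + c)] = ((l ^+ n.+1)^-1%:E * leb_outer Z)%E.
  rewrite (leb_outer_affine c Z l0) muleA -EFinM mulVf ?gt_eqF//.
  by rewrite mul1e.
rewrite {1}XY h (mA Y) ge0_muleDr ?leb_outer_ge0//.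
by rewrite -!h [in RHS]XY.
Qed.

Lemma vol_eball c r : 0 < r -> vol (eball c r) = r ^+ n.+1 * vol (eball (0 : V) 1).
Proof.
move=> r0; rewrite (vol_affine c (eball c r) r0); congr (_ * vol _).
have h x : eball c r (r *: x + c) <-> eball 0 1 x.
  by rewrite !eballE// addrK subr0 esqZ expr1n gtr_pMr ?exprn_gt0.
by apply/seteqP; split => x /= /h.
Qed.

Lemma eball_lty c r : 0 < r -> (leb_outer (eball c r) < +oo)%E.
Proof.
move=> r0; pose e : V := const_mx r.
apply: (@leb_sub_lty _ (hr_box (c - e) (c + e))); last by rewrite leb_outer_box ltry.
move=> x /(coord_lt_eball _ r0) h i; rewrite !mxE.
by have := h i; rewrite ltr_norml => /andP[*]; apply/andP; split; lra.
Qed.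

Lemma vol_eball_gt0 c r : 0 < r -> 0 < vol (eball c r).
Proof.
move=> r0; have [k kr] := cell_sub_eball c r0.
rewrite (lt_le_trans _ (le_vol kr (eball_lty c r0)))//.
by rewrite /vol leb_outer_cellset ?invr_gt0//= exprn_gt0 ?invr_gt0.
Qed.

Lemma ballsU_lty m : posballs m -> (leb_outer (ballsU m : set V) < +oo)%E.
Proof.
elim: m => [_|p m IH m0]; first by rewrite ballsU_nil leb_outer0.
rewrite ballsU_cons; apply: lebU_lty.
  by apply: eball_lty; apply: m0; rewrite mem_head.
by apply: IH => q qm; apply: m0; rewrite inE qm orbT.
Qed.

Lemma eopen_box a b : eopen [set x : V | forall i, a ord0 i < x ord0 i < b ord0 i].
Proof.
move=> x abx.
pose r := \big[Num.min/1]_(i < n.+1) Num.min (x ord0 i - a ord0 i) (b ord0 i - x ord0 i).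
have r0 : 0 < r.
  apply: lt_bigmin => // i _; rewrite lt_min !subr_gt0; exact: abx.
exists r => // y /(coord_lt_eball _ r0) yx i.
have := lt_le_trans (yx i) (bigmin_le _ i _).
by rewrite lt_min !ltr_norml => /andP[/andP[? ?] /andP[? ?]]; apply/andP; split; lra.
Qed.

(** Stretching each half-open box of a good cover by a factor 1 + d, with the upper corner fixed,
    puts the box inside an open one. *)
Lemma leb_outer_regular E (y : R) : (leb_outer E < y%:E)%E ->
  exists G, [/\ eopen G, E `<=` G & (leb_outer G <= y%:E)%E].
Proof.
move=> /ereal_inf_lt[_ [a [b [Eab ->]]] Sy].
set S := (\sum_(k <oo) _)%E in Sy.
have S0 : (0 <= S)%E by apply: nneseries_ge0 => k *; rewrite lee_fin box_vol_ge0.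
have SE : S = (fine S)%:E by rewrite fineK// ge0_fin_numE// (lt_trans Sy)// ltry.
have s0 : 0 <= fine S by exact: fine_ge0.
move: Sy; rewrite SE lte_fin => sy.
(* Stretching costs a factor at most 1 + 2^(n+1) d, so this [d] spends no more than [y - fine S];
   the summand 1 guards against a zero denominator. *)
pose d := Num.min 1 ((y - fine S) / (2 ^+ n.+1 * (fine S + 1))).
have dd0 : 0 < (y - fine S) / (2 ^+ n.+1 * (fine S + 1)).
  by rewrite divr_gt0 ?subr_gt0// mulr_gt0 ?exprn_gt0// ltr_wpDl.
have d0 : 0 < d by rewrite lt_min ltr01.
pose a' k : V := \row_i (b k ord0 i - (1 + d) * (b k ord0 i - a k ord0 i)).
pose F k : set V := [set x | forall i, a' k ord0 i < x ord0 i < b k ord0 i].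
exists (\bigcup_k F k); split.
- by apply: eopen_bigcup => k _; exact: eopen_box.
- move=> x /Eab[k _ abx]; exists k => // i.
  have /andP[h1 h2] := abx i; rewrite h2 andbT mxE.
  have : 0 < d * (b k ord0 i - a k ord0 i).
    by rewrite mulr_gt0// subr_gt0 (le_lt_trans h1 h2).
  by rewrite mulrDl mul1r; lra.
- have vola' k : box_vol (a' k) (b k) = (1 + d) ^+ n.+1 * box_vol (a k) (b k).
    have -> : (1 + d) ^+ n.+1 = \prod_(i < n.+1) (1 + d) by rewrite prodr_const card_ord.
    rewrite /box_vol -big_split/=; apply: eq_bigr => i _.
    rewrite !mxE opprB addrCA subrr addr0 maxr_pMr ?mulr0//.
    by rewrite addr_ge0// ltW.
  have FB : \bigcup_k F k `<=` \bigcup_k hr_box (a' k) (b k).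
    move=> x [k _ Fx]; exists k => // i.
    by have /andP[h ->] := Fx i; rewrite ltW.
  apply: le_trans (leb_outer_le_cover FB) _.
  under eq_eseriesr do rewrite vola' EFinM.
  rewrite nneseriesZl; last by move=> k _; rewrite lee_fin box_vol_ge0.
  rewrite -/S SE -EFinM lee_fin.
  have d1 : 0 <= d <= 1 by rewrite (ltW d0) ge_min lexx.
  apply: (le_trans (ler_wpM2r s0 (expr1D_le n.+1 d1))).
  have : d * (2 ^+ n.+1 * (fine S + 1)) <= y - fine S.
    rewrite -ler_pdivlMr; first by rewrite ge_min lexx orbT.
    by rewrite mulr_gt0 ?exprn_gt0// ltr_wpDl.
  have : 0 <= 2 ^+ n.+1 * d by rewrite mulr_ge0 ?exprn_ge0// ltW.
  by nra.
Qed.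

End volume.

(** * Reduction to finite families of balls *)

Section tauberian.
Context {R : realType} {n : nat}.
Notation V := 'rV[R]_n.+1.
Notation C := (@C_HL_b R n.+1).
Implicit Types (E G : set V) (al K : R) (m : seq (V * R)).

Definition dense_balls al E : set (V * R) :=
  [set p | 0 < p.2 /\ al * vol (eball p.1 p.2) < vol (E `&` eball p.1 p.2)].

Lemma eballI_lty E (c : V) r : 0 < r -> (leb_outer (E `&` eball c r) < +oo)%E.
Proof. by move=> r0; apply: (leb_sub_lty _ (eball_lty c r0)) => x []. Qed.

Lemma M_HL_b_chi_gtE al E :
  [set x | (al%:E < M_HL_b_chi E x)%E] = \bigcup_(p in dense_balls al E) eball p.1 p.2.
Proof.
have key (c : V) r : 0 < r ->
    (al%:E < leb_outer (E `&` eball c r) * ((fine (leb_outer (eball c r)))^-1)%:E)%E =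
    (al * vol (eball c r) < vol (E `&` eball c r)).
  move=> r0; rewrite volE ?eballI_lty// -EFinM lte_fin.
  by rewrite ltr_pdivlMr// vol_eball_gt0.
apply/seteqP; split => [x /= /ereal_sup_gt[_ [c [r [r0 [cx ->]]]]]|x [[c r] [/= r0 h] cx]].
  by rewrite key// => h; exists (c, r).
have : (al%:E < leb_outer (E `&` eball c r) * ((fine (leb_outer (eball c r)))^-1)%:E)%E.
  by rewrite key.
by move=> /lt_le_trans; apply; apply: ereal_sup_ubound; exists c, r.
Qed.

Lemma dense_balls_subset al E G : E `<=` G -> dense_balls al E `<=` dense_balls al G.
Proof.
move=> EG [c r] [/= r0 h]; split => //=; apply: (lt_le_trans h).
by apply: le_vol; [exact: setSI|exact: eballI_lty].
Qed.

Lemma dense_balls_le al be E : al <= be -> dense_balls be E `<=` dense_balls al E.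
Proof.
move=> ab [c r] [/= r0 h]; split => //=; apply: le_lt_trans h.
by rewrite ler_wpM2r// vol_ge0.
Qed.

(** The Tauberian inequality tested only on open sets and finite families of balls; [C_HL_b_le]
    shows that this already controls the supremum. *)
Definition tauberian_bound al K := forall G m, eopen G -> (leb_outer G < +oo)%E -> 0 < vol G ->
  (forall p, p \in m -> dense_balls al G p) -> vol (ballsU m) <= K * vol G.

Lemma posballs_dense_balls al G m : (forall p, p \in m -> dense_balls al G p) -> posballs m.
Proof. by move=> h p /h[]. Qed.

(** A measurable [E] is enclosed in an open [G] of nearly the same measure. Balls dense for [E] are
    dense for [G], and finite subfamilies suffice for their union. *)
Lemma C_HL_b_le al K : 0 <= K -> tauberian_bound al K -> (C al <= K%:E)%E.
Proof.
move=> K0 TK; apply: ge_ereal_sup => _ [E [mE E0 Eoo ->]].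
have vE : 0 < vol E by rewrite -lte_fin -volE.
suff h : (leb_outer [set x | al%:E < M_HL_b_chi E x] <= (K * vol E)%:E)%E.
  rewrite volE; last by rewrite (le_lt_trans h)// ltry.
  rewrite -EFinM lee_fin ler_pdivrMr//.
  by rewrite -lee_fin -volE// (le_lt_trans h)// ltry.
apply/lee_addgt0Pr => e e0; rewrite -EFinD M_HL_b_chi_gtE.
pose d := e / (K + 1).
have d0 : 0 < d by rewrite divr_gt0// ltr_wpDl.
have Kd : K * d <= e.
  by rewrite /d mulrCA ler_piMr ?(ltW e0)// ler_pdivrMr ?mul1r ?lerDl// ltr_wpDl.
have [|G [oG EG Gd]] := @leb_outer_regular _ _ E (vol E + d).
  by rewrite volE// lte_fin ltrDl.
have Goo : (leb_outer G < +oo)%E by rewrite (le_lt_trans Gd)// ltry.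
have vG : vol G <= vol E + d by rewrite -lee_fin -volE.
apply: (@le_trans _ _ (K * vol G)%:E); last first.
  by rewrite lee_fin (le_trans (ler_wpM2l K0 vG))// mulrDr lerD2l.
apply: leb_outer_balls_le => [p []//|m mE'].
have mG p : p \in m -> dense_balls al G p by move=> /mE'; exact: dense_balls_subset.
rewrite volE ?lee_fin; last by apply: ballsU_lty; exact: posballs_dense_balls mG.
by apply: TK => //; apply: lt_le_trans vE _; exact: le_vol.
Qed.

Lemma leb_outer_M_le al K E : (C al <= K%:E)%E -> leb_measurable E ->
  (leb_outer E < +oo)%E -> 0 < vol E ->
  (leb_outer (\bigcup_(p in dense_balls al E) eball p.1 p.2) <= (K * vol E)%:E)%E.
Proof.
move=> CK mE Eoo E0; rewrite -M_HL_b_chi_gtE.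
rewrite EFinM -lee_pdivrMr//; apply: le_trans CK.
by apply: ereal_sup_ubound; exists E; split => //; rewrite volE// lte_fin.
Qed.

Lemma vol_ballsU_le al K E m : (C al <= K%:E)%E -> leb_measurable E ->
  (leb_outer E < +oo)%E -> 0 < vol E -> (forall p, p \in m -> dense_balls al E p) ->
  vol (ballsU m) <= K * vol E.
Proof.
move=> CK mE Eoo E0 mEp; have h := leb_outer_M_le CK mE Eoo E0.
rewrite -lee_fin -volE; last by apply: ballsU_lty; exact: posballs_dense_balls mEp.
by apply: le_trans h; apply: le_leb_outer => x [p /mEp]; exists p.
Qed.

(** Around each point of the open set [G] a small ball inside [G] has average 1 > [al], so [G]
    itself belongs to the superlevel set. This later produces the factor [Kb - 1] instead of
    [Kb]. *)
Lemma vol_ballsU_open_le al K G m : al < 1 -> (C al <= K%:E)%E -> eopen G ->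
  (leb_outer G < +oo)%E -> 0 < vol G -> (forall p, p \in m -> dense_balls al G p) ->
  vol (ballsU m `|` G) <= K * vol G.
Proof.
move=> al1 CK oG Goo G0 mG; have h := leb_outer_M_le CK (leb_measurable_eopen oG) Goo G0.
rewrite -lee_fin -volE; last first.
  by apply: lebU_lty => //; apply: ballsU_lty; exact: posballs_dense_balls mG.
apply: le_trans h; apply: le_leb_outer => x [[p /mG]|Gx]; first by exists p.
have [r r0 rG] := oG x Gx; exists (x, r); last exact: eball_center.
split => //=; rewrite setIC setIidl// gtr_pMl// vol_eball_gt0//.
Qed.

Lemma C_HL_b_ge1 al K : al < 1 -> (C al <= K%:E)%E -> 1 <= K.
Proof.
move=> al1 CK; have b0 := @vol_eball_gt0 _ _ (0 : V) _ (@ltr01 R).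
have boo := @eball_lty _ _ (0 : V) _ (@ltr01 R).
(* With no balls at all, the bound reads |G| <= K |G| for the unit ball. *)
have := @vol_ballsU_open_le al K (eball 0 1) [::] al1 CK.
rewrite ballsU_nil set0U -{2}(mul1r (vol _)) ler_pM2r//; apply => //.
exact: eopen_eball.
Qed.

Lemma tauberian_bound_C_HL_b al K : (C al <= K%:E)%E -> tauberian_bound al K.
Proof.
move=> CK G m oG Goo G0 mG; apply: vol_ballsU_le CK _ _ _ mG => //.
exact: leb_measurable_eopen.
Qed.

Lemma C_HL_b_ge0 al : (0 <= C al)%E.
Proof.
apply: (@le_trans _ _ (leb_outer [set x | (al%:E < M_HL_b_chi (eball (0 : V) 1) x)%E] *
           ((fine (leb_outer (eball (0 : V) 1)))^-1)%:E)%E).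
  by rewrite mule_ge0 ?leb_outer_ge0// lee_fin invr_ge0 vol_ge0.
apply: ereal_sup_ubound; exists (eball (0 : V) 1); split => //.
- exact: leb_measurable_eball.
- by rewrite volE ?eball_lty// lte_fin vol_eball_gt0.
- exact: eball_lty.
Qed.

Lemma C_HL_b_nonincreasing al be : al <= be -> (C be <= C al)%E.
Proof.
move=> ab; have := @tauberian_bound_C_HL_b al; have := C_HL_b_ge0 al.
case: (C al) => [K|_ _|//]; last by rewrite leey.
rewrite lee_fin => K0 TK; apply: C_HL_b_le => // G m oG Goo G0 mG.
by apply: TK => // p /mG; exact: dense_balls_le.
Qed.

End tauberian.

Lemma exists_maximal (T : eqType) (R : realDomainType) (f : T -> R) (m : seq T) :
  m != [::] -> exists2 p, p \in m & forall q, q \in m -> f q <= f p.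
Proof.
elim: m => // p m IH _; have [->|/IH[q qm qmax]] := eqVneq m [::].
  by exists p; rewrite ?mem_head// => q; rewrite mem_seq1 => /eqP ->.
have [pq|qp] := leP (f p) (f q).
  exists q; first by rewrite inE qm orbT.
  by move=> x; rewrite inE => /orP[/eqP ->|/qmax].
exists p; first exact: mem_head.
move=> x; rewrite inE => /orP[/eqP ->//|/qmax h]; exact: le_trans h (ltW qp).
Qed.

Lemma size_filter_lt (T : eqType) (a : pred T) (m : seq T) p : p \in m -> ~~ a p ->
  (size [seq x <- m | a x] < size m)%N.
Proof.
move=> pm ap; rewrite size_filter ltn_neqAle count_size andbT -all_count.
by apply/allPn; exists p.
Qed.

(** * Finiteness of the Tauberian constant by Vitali selection *)

Section weak_type.
Context {R : realType} {n : nat}.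
Notation V := 'rV[R]_n.+1.
Implicit Types (E G : set V) (al K : R) (m : seq (V * R)).

Lemma eball_triple (c d : V) (r s : R) : 0 < r -> 0 < s -> s <= r ->
  eball c r `&` eball d s !=set0 -> eball d s `<=` eball c (3 * r).
Proof.
move=> r0 s0 sr [y [cy dy]] x dx.
have -> : 3 * r = r + 2 * r by ring.
apply: (eballD r0 _ cy); first by rewrite mulr_gt0.
have -> : x - y = (x - d) - (y - d) by rewrite opprB addrA subrK.
move: dx dy => /(eballE _ _ s0) dx /(eballE _ _ s0) /ltW dy.
have := esqD_lt s0 s0 dx; rewrite -(esqN (y - d)) in dy => /(_ _ dy)/ltW h.
apply: (le_trans h); rewrite ler_sqr ?nnegrE ?addr_ge0 ?mulr_ge0 ?(ltW r0) ?(ltW s0)//; lra.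
Qed.

(** A largest ball is selected; the balls meeting it lie in its triple, and the others are handled
    by induction. Measuring [E] only inside [ballsU m] makes the right sides add up, as the
    remaining balls are disjoint from the selected one. *)
Lemma weak_type_balls al E m : 0 < al -> (forall p, p \in m -> dense_balls al E p) ->
  vol (ballsU m) <= 3 ^+ n.+1 / al * vol (E `&` ballsU m).
Proof.
move=> al0; have K0 : 0 < 3 ^+ n.+1 / al by rewrite divr_gt0// exprn_gt0.
have [k] := ubnP (size m); elim: k m => // k IH m; rewrite ltnS => mk mE.
have [->|m0] := eqVneq m [::]; first by rewrite ballsU_nil vol0 mulr_ge0 ?vol_ge0// ltW.
have [[c r] pm pmax] := exists_maximal snd m0.
have [/= r0 cr] := mE _ pm.
have posm : posballs m by exact: posballs_dense_balls mE.
pose a (q : V * R) : bool := ~~ `[< eball c r `&` eball q.1 q.2 !=set0 >].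
pose m' := [seq q <- m | a q].
have m'm : {subset m' <= m} by move=> q; rewrite mem_filter => /andP[].
have mm' : ballsU m `<=` eball c (3 * r) `|` ballsU m'.
  move=> x [q qm qx]; have [aq|] := boolP (a q).
    by right; exists q => //=; rewrite mem_filter aq.
  rewrite negbK => /asboolP h; left; apply: eball_triple h _ qx => //.
    exact: posm.
  exact: pmax.
have posm' : posballs m' by move=> q /m'm/posm.
have r3 : 0 < 3 * r by rewrite mulr_gt0.
have Eoo : (leb_outer (E `&` ballsU m) < +oo)%E.
  by apply: (leb_sub_lty _ (ballsU_lty posm)) => x [].
have IHm' : vol (ballsU m') <= 3 ^+ n.+1 / al * vol (E `&` ballsU m').
  apply: IH => [|q /m'm/mE//]; apply: leq_trans mk.
  apply: (size_filter_lt pm); rewrite negbK; apply/asboolP.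
  by exists c; split; exact: eball_center.
apply: (@le_trans _ _ (3 ^+ n.+1 * vol (eball c r) + vol (ballsU m'))).
  rewrite vol_eball// mulrA -exprMn -(vol_eball c)//.
  apply: (le_trans (le_vol mm' _) (volU_le _ _)); rewrite ?eball_lty ?ballsU_lty//.
  by apply: lebU_lty; rewrite ?eball_lty ?ballsU_lty.
rewrite (vol_split (leb_measurable_eball c r0) Eoo) mulrDr lerD//.
- apply: (@le_trans _ _ (3 ^+ n.+1 / al * vol (E `&` eball c r))).
    rewrite -mulrA ler_pM2l ?exprn_gt0// mulrC ler_pdivlMr// mulrC ltW//.
  rewrite ler_pM2l//; apply: le_vol; last by apply: leb_sub_lty Eoo => x [].
  by move=> x [Ex cx]; split => //; split => //; exists (c, r).
- apply: (le_trans IHm'); rewrite ler_pM2l//; apply: le_vol; last first.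
    by apply: leb_sub_lty Eoo => x [].
  move=> x [Ex [q qm' qx]]; split; first by split => //; exists q => //; exact: m'm.
  move=> cx; move: qm'; rewrite /= mem_filter => /andP[/asboolP]; case.
  by exists x.
Qed.

Lemma C_HL_b_weak_type al : 0 < al -> (@C_HL_b R n.+1 al <= (3 ^+ n.+1 / al)%:E)%E.
Proof.
move=> al0; have K0 : 0 < 3 ^+ n.+1 / al by rewrite divr_gt0// exprn_gt0.
apply: C_HL_b_le => [|G m oG Goo G0 mG]; first exact: ltW.
apply: (le_trans (weak_type_balls al0 mG)); rewrite ler_pM2l//.
by apply: le_vol => // x [].
Qed.

End weak_type.

(** * Comparison of Tauberian constants at two levels *)

Section homogenization.
Context {R : realType} {n : nat}.
Notation V := 'rV[R]_n.+1.
Implicit Types (A E G F : set V) (al be t : R) (m : seq (V * R)).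

Definition coord0_lt (s : R) : set V := [set x | x ord0 ord0 < s].

Lemma vol_slab A (e s s' : R) : 0 <= e -> A `<=` hr_box (const_mx (- e)) (const_mx e) ->
  s <= s' -> vol (A `&` coord0_lt s') - vol (A `&` coord0_lt s) <= (2 * e) ^+ n * (s' - s).
Proof.
move=> e0 Ae ss'.
have Aoo : (leb_outer A < +oo)%E.
  by apply: (leb_sub_lty Ae); rewrite leb_outer_box ltry.
pose a : V := \row_i (if i == ord0 then s else - e).
pose b : V := \row_i (if i == ord0 then s' else e).
rewrite (@vol_split _ _ (coord0_lt s) (A `&` coord0_lt s')); first last.
- by apply: leb_sub_lty Aoo => x [].
- exact: leb_measurable_halfspace.
have -> : A `&` coord0_lt s' `&` coord0_lt s = A `&` coord0_lt s.
  apply/seteqP; split => [x [[Ax _] xs]//|x [Ax xs]]; split => //; split => //.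
  exact: lt_le_trans ss'.
rewrite addrC addKr.
have -> : (2 * e) ^+ n * (s' - s) = vol (hr_box a b).
  rewrite /vol leb_outer_box/= /box_vol big_ord_recl !mxE eqxx max_l ?subr_ge0//.
  rewrite mulrC; congr (_ * _).
  rewrite (eq_bigr (fun=> 2 * e)); first by rewrite prodr_const card_ord.
  move=> i _; rewrite !mxE; have -> /= : (lift ord0 i == ord0 :> 'I_n.+1) = false by [].
  by rewrite opprK max_l ?addr_ge0//; ring.
apply: le_vol; last by rewrite leb_outer_box ltry.
move=> x [[/Ae Ax /= xs'] /negP xs] i; rewrite !mxE.
case: eqP => [->|_]; first by rewrite xs' andbT leNgt.
by have := Ax i; rewrite !mxE.
Qed.

(** The part of [A] below a moving hyperplane has volume Lipschitz in the position of the
    hyperplane, by [vol_slab], and runs from 0 to [vol A]; the intermediate value theorem gives the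
    right cut. *)
Lemma exists_fraction A t (e : R) : 0 <= e -> leb_measurable A ->
  A `<=` hr_box (const_mx (- e)) (const_mx e) -> 0 <= t <= 1 ->
  exists F, [/\ leb_measurable F, F `<=` A & vol F = t * vol A].
Proof.
move=> e0 mA Ae /andP[t0 t1].
have Aoo : (leb_outer A < +oo)%E.
  by apply: (leb_sub_lty Ae); rewrite leb_outer_box ltry.
pose g s := vol (A `&` coord0_lt s).
have gmono s s' : s <= s' -> g s <= g s'.
  move=> ss'; apply: le_vol; last by apply: leb_sub_lty Aoo => x [].
  by move=> x [Ax xs]; split => //; exact: lt_le_trans ss'.
pose L := (2 * e) ^+ n + 1.
have L0 : 0 < L by rewrite ltr_wpDl// exprn_ge0// mulr_ge0.
have glip s s' : `|g s - g s'| <= L * `|s - s'|.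
  wlog ss' : s s' / s' <= s => [h|].
    by have [/h//|/ltW/h] := leP s' s; rewrite distrC [X in _ * X]distrC.
  rewrite !ger0_norm ?subr_ge0 ?gmono//; apply: (le_trans (vol_slab e0 Ae ss')).
  by rewrite ler_wpM2r ?subr_ge0// lerDl.
have gcont : continuous g.
  move=> s; apply/cvgrPdist_le => d d0; near=> u.
  apply: (le_trans (glip _ _)); rewrite mulrC -ler_pdivlMr//.
  near: u; apply: cvgr_dist_le; first exact: cvg_id.
  exact: divr_gt0.
have ge : g e = vol A.
  rewrite /g setIidl// => x /Ae /(_ ord0); rewrite !mxE => /andP[_]; exact.
have gNe : g (- e) = 0.
  rewrite /g (_ : _ `&` _ = set0) ?vol0//; apply/seteqP; split => // x [/Ae /(_ ord0)].
  by rewrite !mxE /coord0_lt/= leNgt => /andP[/negP].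
have ee : - e <= e by rewrite (le_trans _ e0)// oppr_le0.
have [|s _ gs] := @IVT _ g (- e) e (t * vol A) ee (continuous_subspaceT gcont).
  rewrite ge gNe min_l ?vol_ge0// max_r ?vol_ge0// mulr_ge0 ?vol_ge0//=.
  by rewrite ler_piMl// vol_ge0.
exists (A `&` coord0_lt s); split; [|by move=> x []|exact: gs].
by apply: leb_measurableI; [exact: mA|exact: leb_measurable_halfspace].
Unshelve. all: by end_near. Qed.

(* A discrete stand-in for [t * \1_A]: on finitely many balls a genuine set [F]
   has the same averages as this density. *)
Lemma exists_homogenized A t (e : R) m : 0 <= e -> leb_measurable A ->
  A `<=` hr_box (const_mx (- e)) (const_mx e) -> 0 <= t <= 1 -> posballs m ->
  exists F, [/\ leb_measurable F, F `<=` A, vol F = t * vol A &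
    forall p, p \in m -> vol (F `&` eball p.1 p.2) = t * vol (A `&` eball p.1 p.2)].
Proof.
move=> e0 + + t01; elim: m A => [|p m IH] A mA Ae posm.
  by have [F [mF FA vF]] := exists_fraction e0 mA Ae t01; exists F.
have p0 : 0 < p.2 by apply: posm; rewrite mem_head.
have posm' : posballs m by move=> q qm; apply: posm; rewrite inE qm orbT.
have mp := leb_measurable_eball p.1 p0.
pose B := eball p.1 p.2.
have Aoo : (leb_outer A < +oo)%E.
  by apply: (leb_sub_lty Ae); rewrite leb_outer_box ltry.
(* Treating the parts of [A] inside and outside the new ball separately fixes the proportion on that
   ball, while the two proportions [t] still add up on every other ball. *)
have [|x [/Ae//]|F1 [mF1 F1A vF1 F1m]] := IH (A `&` B) _ _ posm'.
  exact: leb_measurableI.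
have [|x [/Ae//]|F2 [mF2 F2A vF2 F2m]] := IH (A `\` B) _ _ posm'.
  exact: leb_measurableD.
have F1oo : (leb_outer F1 < +oo)%E by apply: leb_sub_lty Aoo => x /F1A[].
have F2oo : (leb_outer F2 < +oo)%E by apply: leb_sub_lty Aoo => x /F2A[].
have F12 X : vol ((F1 `|` F2) `&` X) = vol (F1 `&` X) + vol (F2 `&` X).
  rewrite (vol_split mp); last by apply: (leb_sub_lty _ (lebU_lty F1oo F2oo)) => x [].
  congr (_ + _); congr vol; apply/seteqP; split.
  - by move=> x [[[//|/F2A[_ h]] Xx] Bx].
  - by move=> x [F1x Xx]; split; [split => //; left|exact: (F1A _ F1x).2].
  - by move=> x [[[/F1A[_ h]|//] Xx] Bx].
  - by move=> x [F2x Xx]; split; [split => //; right|exact: (F2A _ F2x).2].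
have AX X : vol (A `&` X) = vol (A `&` B `&` X) + vol ((A `\` B) `&` X).
  rewrite (vol_split mp); last by apply: (leb_sub_lty _ Aoo) => x [].
  by congr (_ + _); congr vol; apply/seteqP; split=> x; rewrite /B /=; tauto.
exists (F1 `|` F2); split.
- exact: leb_measurableU.
- by move=> x [/F1A[]|/F2A[]].
- have := F12 setT; rewrite !setIT => ->; rewrite vF1 vF2 -mulrDr; congr (_ * _).
  by have := AX setT; rewrite !setIT => ->.
- move=> q; rewrite inE => /orP[/eqP ->|qm]; last first.
    by rewrite F12 F1m// F2m// -mulrDr -AX.
  rewrite F12 (setIidl (_ : F1 `<=` _)); last by move=> x /F1A[].
  rewrite (_ : F2 `&` _ = set0) ?vol0 ?addr0//.
  by apply/seteqP; split => // x [/F2A[_]].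
Qed.

Lemma ballsU_bounded m : posballs m ->
  exists2 e, 0 <= e & ballsU m `<=` hr_box (const_mx (- e)) (const_mx e).
Proof.
elim: m => [_|[c r] m IH posm]; first by exists 0 => //; rewrite ballsU_nil.
have [|e e0 me] := IH; first by move=> q qm; apply: posm; rewrite inE qm orbT.
have r0 : 0 < r by apply: (posm (c, r)); rewrite mem_head.
pose d := e + r + \sum_(i < n.+1) `|c ord0 i|.
have cd i : `|c ord0 i| + r + e <= d.
  have : `|c ord0 i| <= \sum_(j < n.+1) `|c ord0 j| by rewrite (bigD1 i)//= lerDl sumr_ge0.
  by rewrite /d; lra.
exists d; first by rewrite /d !addr_ge0 ?(ltW r0)// sumr_ge0.
rewrite ballsU_cons => x [/(coord_lt_eball _ r0) cx|/me xe] i.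
  have := cd i; have := cx i; rewrite !mxE ltr_norml => /andP[h1 h2] h3.
  have := ler_norm (c ord0 i); have := ler_norm (- c ord0 i); rewrite normrN => h4 h5.
  by apply/andP; split; lra.
have := xe i; have := cd i; rewrite !mxE; have := normr_ge0 (c ord0 i).
by move=> h1 h2 /andP[h3 h4]; apply/andP; split; lra.
Qed.

Lemma C_HL_b_compare be al Kb Ka : be < al -> al < 1 ->
  (@C_HL_b R n.+1 be <= Kb%:E)%E -> (@C_HL_b R n.+1 al <= Ka%:E)%E ->
  (@C_HL_b R n.+1 be <= (Ka * (1 + (al - be) / (1 - be) * (Kb - 1)))%:E)%E.
Proof.
move=> ba a1 CKb CKa; have b1 : be < 1 by exact: lt_trans a1.
have Ka1 := C_HL_b_ge1 a1 CKa; have Kb1 := C_HL_b_ge1 b1 CKb.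
(* Chosen so that be + t (1 - be) = al: density [t] on the complement lifts an average [be] to
   [al]. *)
set t := (al - be) / (1 - be).
have t0 : 0 < t by rewrite divr_gt0// subr_gt0.
have t1 : t <= 1 by rewrite ler_pdivrMr ?subr_gt0// mul1r; lra.
apply: C_HL_b_le.
  rewrite mulr_ge0//; first by rewrite (le_trans _ Ka1).
  by rewrite addr_ge0// mulr_ge0 ?subr_ge0// ltW.
move=> G m oG Goo G0 mG; have posm := posballs_dense_balls mG.
have mGm := leb_measurable_eopen oG.
pose U := ballsU m; have mU := leb_measurable_ballsU posm.
have Uoo := ballsU_lty posm.
have [e e0 Ue] := ballsU_bounded posm.
have [||| |F [mF FA vF Fm]] := @exists_homogenized (U `\` G) t e m e0.
- exact: leb_measurableD.
- by move=> x [/Ue].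
- by rewrite t1 ltW.
- by [].
have Foo : (leb_outer F < +oo)%E by apply: (leb_sub_lty _ Uoo) => x /FA[].
have GF : G `&` F `<=` set0 by move=> x [Gx /FA[]].
have UG : vol (U `\` G) <= (Kb - 1) * vol G.
  rewrite mulrBl mul1r lerBrDl.
  rewrite -volU//; [|by move=> x [Gx []]|by apply: (leb_sub_lty _ Uoo) => x []].
  rewrite (_ : G `|` _ = U `|` G); first exact: vol_ballsU_open_le b1 CKb oG Goo G0 mG.
  apply/seteqP; split => x; first by move=> [Gx|[Ux _]]; [right|left].
  by move=> [Ux|Gx]; [have [Gx|] := pselect (G x); [left|right]|left].
have : vol U <= Ka * vol (G `|` F).
  apply: (vol_ballsU_le CKa).
  - exact: leb_measurableU.
  - exact: lebU_lty.
  - by rewrite volU// ltr_wpDr// vol_ge0.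
  - move=> p pm; have [p0 hp] := mG _ pm; split => //.
    set B := eball p.1 p.2 in hp *.
    have Boo : (leb_outer B < +oo)%E by exact: eball_lty.
    have -> : vol ((G `|` F) `&` B) = vol (G `&` B) + vol (F `&` B).
      rewrite setIUl volU//; first by apply: leb_measurableI => //; exact: leb_measurable_eball.
      - by move=> x [[Gx _] [Fx _]]; exact: (GF x).
      - exact: eballI_lty.
      - exact: eballI_lty.
    have -> : vol (F `&` B) = t * (vol B - vol (G `&` B)).
      rewrite Fm//; congr (_ * _); rewrite [vol B](vol_split mGm Boo).
      rewrite (setIC G B) addrAC subrr add0r; congr vol; apply/seteqP; split.
        by move=> x [[_ Gx] Bx].
      by move=> x [Bx Gx]; split => //; split => //; exists p.
    have tE : t * (1 - be) = al - be by rewrite divfK// gt_eqF// subr_gt0.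
    have := vol_eball_gt0 p.1 p0; rewrite -/B => B0.
    (* [t = 1] would force [al = 1]; the strict inequality keeps the average of [G] strictly
       dominant after scaling by [1 - t]. *)
    have [t1'|t1'] := ltP t 1; last first.
      have : t = 1 by apply/eqP; rewrite eq_le t1.
      by move=> tt; move: tE; rewrite tt; lra.
    have -> : al = be + t * (1 - be) by rewrite tE; ring.
    have : (1 - t) * (be * vol B) < (1 - t) * vol (G `&` B) by rewrite ltr_pM2l ?subr_gt0.
    lra.
move=> /le_trans; apply.
rewrite -mulrA ler_wpM2l//; first by rewrite (le_trans _ Ka1).
rewrite volU// vF mulrDl mul1r lerD2l -mulrA ler_wpM2l//; exact: ltW.
Qed.

End homogenization.

(** * Solyanik estimate *)

Section dilated_balls.
Context {R : realType} {n : nat}.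
Notation V := 'rV[R]_n.+1.
Implicit Types (X : set V) (c x y : V) (m : seq (V * R)) (F : nat -> set V).

Lemma vol_le_sum F k X : (leb_outer X < +oo)%E ->
  (forall j, (j < k)%N -> (leb_outer (F j) < +oo)%E) ->
  (forall x, X x -> exists2 j, (j < k)%N & F j x) ->
  vol X <= \sum_(j < k) vol (F j).
Proof.
elim: k X => [|k IH] X Xoo Foo XF.
  rewrite big_ord0 (_ : X = set0) ?vol0//.
  by apply/seteqP; split => // x /XF[].
have X1oo : (leb_outer (X `&` F k) < +oo)%E by apply: leb_sub_lty Xoo => x [].
have X2oo : (leb_outer (X `\` F k) < +oo)%E by apply: leb_sub_lty Xoo => x [].
rewrite big_ord_recr/= addrC -{1}(setUIDK X (F k)).
apply: (le_trans (volU_le X1oo X2oo)); apply: lerD.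
  by apply: le_vol; [move=> x []|exact: Foo].
apply: IH => // [j jk|x [/XF[j jk Fx] nF]]; first by apply: Foo; exact: ltnW.
exists j => //; move: jk; rewrite ltnS leq_eqVlt => /orP[/eqP jk|//].
by case: nF; rewrite -jk.
Qed.

Lemma sum_vol_le F k X : (leb_outer X < +oo)%E ->
  (forall j, (j < k)%N -> leb_measurable (F j)) ->
  (forall j, (j < k)%N -> F j `<=` X) ->
  (forall i j x, (i < j)%N -> (j < k)%N -> F i x -> F j x -> False) ->
  \sum_(j < k) vol (F j) <= vol X.
Proof.
elim: k X => [|k IH] X Xoo mF FX Fdisj; first by rewrite big_ord0 vol_ge0.
rewrite big_ord_recr/= addrC (vol_split (mF k (ltnSn k)) Xoo); apply: lerD.
  apply: le_vol; last by apply: leb_sub_lty Xoo => x [].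
  by move=> x Fx; split => //; exact: FX Fx.
apply: IH.
- by apply: leb_sub_lty Xoo => x [].
- by move=> j jk; apply: mF; exact: ltnW.
- move=> j jk x Fx; split; first by apply: FX Fx; exact: ltnW.
  by move=> Fkx; exact: (Fdisj j k x).
- by move=> i j x ij jk; apply: Fdisj => //; exact: ltnW.
Qed.

Definition dot x y : R := \sum_(i < n.+1) x ord0 i * y ord0 i.

Lemma esqB x y : esq (x - y) = esq x - 2 * dot y x + esq y.
Proof.
rewrite /esq /dot mulr_sumr -sumrB -big_split/=; apply: eq_bigr => i _.
by rewrite !mxE; ring.
Qed.

Lemma dotBl x y c : dot (x - y) c = dot x c - dot y c.
Proof.
by rewrite /dot -sumrB; apply: eq_bigr => i _; rewrite !mxE mulrBl.
Qed.

Lemma dotDr x y c : dot c (x + y) = dot c x + dot c y.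
Proof.
by rewrite /dot -big_split; apply: eq_bigr => i _; rewrite !mxE mulrDr.
Qed.

Lemma dotZr (a : R) x c : dot c (a *: x) = a * dot c x.
Proof.
by rewrite /dot mulr_sumr; apply: eq_bigr => i _; rewrite !mxE mulrCA.
Qed.

Lemma dotC x y : dot x y = dot y x.
Proof. by apply: eq_bigr => i _; rewrite mulrC. Qed.

Lemma dotxx x : dot x x = esq x.
Proof. by apply: eq_bigr => i _; rewrite expr2. Qed.

Lemma esq_le0 x : esq x <= 0 -> x = 0.
Proof.
move=> x0; have /eqP : esq x = 0 by apply/eqP; rewrite eq_le x0 esq_ge0.
rewrite psumr_eq0; last by move=> i _; exact: sqr_ge0.
move=> /allP h; apply/rowP => i; rewrite mxE.
by have := h i (mem_index_enum i); rewrite sqrf_eq0 => /eqP.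
Qed.

Section power_cells.
Variables (m : seq (V * R)) (lam : R).
Hypotheses (posm : posballs m) (lam1 : 1 < lam).

Let k := size m.
Let ctr j := (nth (0, 1) m j).1.
Let rad j := (nth (0, 1) m j).2.
Let rad0 j : (j < k)%N -> 0 < rad j.
Proof. by move=> jk; apply: posm; exact: mem_nth. Qed.
Let lam0 : 0 < lam. Proof. exact: lt_trans lam1. Qed.

(** The power distance to the dilated sphere [j], negative inside it. The sets [pcell0 j] are the
    cells of the power diagram, cut down to the dilated balls; [pcell] gives ties to the least
    index. *)
Let power j x := esq (x - ctr j) - (lam * rad j) ^+ 2.
Let pcell0 j := [set x | power j x < 0 /\ forall i, (i < k)%N -> power j x <= power i x].
Let pcell j := [set x | pcell0 j x /\ forall i, (i < j)%N -> ~ pcell0 i x].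

(** The quadratic terms cancel, which leaves a half-space. *)
Let measurable_power_lt i j : leb_measurable [set x | power i x < power j x].
Proof.
apply: leb_measurable_eopen.
have -> : [set x | power i x < power j x] =
    [set x | \sum_(l < n.+1) (ctr j - ctr i) ord0 l * x ord0 l <
      (esq (ctr j) - esq (ctr i) + (lam * rad i) ^+ 2 - (lam * rad j) ^+ 2) / 2].
  apply/funext => x /=; rewrite -/(dot _ _) dotBl /power !esqB ltr_pdivlMr//.
  by apply/propext; split; lra.
exact: eopen_halfspace.
Qed.

Let measurable_pcell0 j : (j < k)%N -> leb_measurable (pcell0 j).
Proof.
move=> jk.
have -> : pcell0 j = eball (ctr j) (lam * rad j) `&`
    ~` (\bigcup_i (if (i < k)%N then [set x | power i x < power j x] else set0)).
  have r0 : 0 < lam * rad j by rewrite mulr_gt0// rad0.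
  apply/seteqP; split => [x [h1 h2]|x [/eballE - /(_ r0) h1 h2]]; split.
  - by apply/eballE => //; rewrite -subr_lt0.
  - by move=> [i _]; case: ifP => // /h2; rewrite /= ltNge => ->.
  - by rewrite /power subr_lt0.
  - move=> i ik; rewrite leNgt; apply/negP => h; apply: h2; exists i => //.
    by rewrite ik.
apply: leb_measurableI; first by apply: leb_measurable_eball; rewrite mulr_gt0// rad0.
apply: leb_measurableC; apply: leb_measurable_bigcup => i.
by case: ifP => _; [exact: measurable_power_lt|exact: leb_measurable0].
Qed.

Let measurable_pcell j : (j < k)%N -> leb_measurable (pcell j).
Proof.
move=> jk.
have -> : pcell j = pcell0 j `&` ~` (\bigcup_i (if (i < j)%N then pcell0 i else set0)).
  apply/seteqP; split => [x [h1 h2]|x [h1 h2]]; split => //.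
    by move=> [i _]; case: ifP => // /h2.
  by move=> i ij px; apply: h2; exists i => //; rewrite ij.
apply: leb_measurableI; first exact: measurable_pcell0.
apply: leb_measurableC; apply: leb_measurable_bigcup => i.
case: ifP => [ij|_]; last exact: leb_measurable0.
by apply: measurable_pcell0; exact: ltn_trans jk.
Qed.

Let shift j := (1 - lam) *: ctr j.
(** The cell [j] contracted by the factor [lam] about its own centre, hence a part of the undilated
    ball. *)
Let shrunk j := [set y | pcell j (lam *: y + shift j)].

(* Minimality of the power distances at [x = lam y + (1 - lam) c_i] and
   [z = lam y + (1 - lam) c_j] gives [<x - z, c_i - c_j> >= 0], whereas
   [x - z = - (lam - 1) (c_i - c_j)]. *)
Let shrunk_disjoint i j y : (i < j)%N -> (j < k)%N -> shrunk i y -> shrunk j y -> False.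
Proof.
move=> ij jk [[hi1 hi2] _] [[hj1 hj2] hj3].
have ik := ltn_trans ij jk.
have := hi2 _ jk; have := hj2 _ ik; rewrite /power !esqB !dotDr /shift !dotZr !dotxx.
rewrite [dot (ctr j) (ctr i)]dotC => h1 h2.
(* Adding the two minimality inequalities cancels the radii and leaves (lam - 1) |c_i - c_j|^2 <=
   0. *)
have cc : ctr i = ctr j.
  apply/eqP; rewrite -subr_eq0; apply/eqP/esq_le0; rewrite esqB.
  rewrite [dot (ctr j) (ctr i)]dotC.
  rewrite -(@pmulr_rle0 _ (lam - 1)) ?subr_gt0//; lra.
(* With equal centres the two points coincide, and [pcell j] excludes the points of [pcell0 i]. *)
by apply: (hj3 i ij); rewrite /shift -cc.
Qed.

(** The power cells cover the dilated union. Contracted about their centres they are pairwise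
    disjoint and lie in the original balls, and each contraction divides the volume by
    [lam ^+ n.+1]. *)
Lemma vol_dilated_balls :
  vol (ballsU [seq (p.1, lam * p.2) | p <- m]) <= lam ^+ n.+1 * vol (ballsU m).
Proof.
have poslam : posballs [seq (p.1, lam * p.2) | p <- m].
  by move=> _ /mapP[p pm ->] /=; rewrite mulr_gt0//; exact: posm.
have pcelloo j : (j < k)%N -> (leb_outer (pcell j) < +oo)%E.
  move=> jk; have r0 : 0 < lam * rad j by rewrite mulr_gt0// rad0.
  apply: (leb_sub_lty _ (eball_lty (ctr j) r0)) => x [[h _] _].
  by apply/eballE => //; rewrite -subr_lt0.
apply: (@le_trans _ _ (\sum_(j < k) vol (pcell j))).
  apply: vol_le_sum => //; first exact: ballsU_lty.
  move=> x [_ /= /mapP[p pm ->]] /eballE /=.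
  have p0 := posm pm; rewrite mulr_gt0// => /(_ isT) px.
  have k0 : iota 0 k != [::] by rewrite -size_eq0 size_iota /k; case: m pm.
  have [j0 j0k hj0] := exists_maximal (fun j => - power j x) k0.
  have pj0 : pcell0 j0 x.
    have hmin i : (i < k)%N -> power j0 x <= power i x.
      by move=> ik; rewrite -lerN2; apply: hj0; rewrite mem_iota.
    split => //; apply: le_lt_trans (hmin (index p m) _) _; first by rewrite index_mem.
    by rewrite /power /ctr /rad nth_index// subr_lt0.
  have ex : exists j, `[< pcell0 j x >] by exists j0; apply/asboolP.
  have [j /asboolP pj jmin] := ex_minnP ex.
  exists j; last first.
    split => // i ij /asboolP /jmin; by rewrite leqNgt ij.
  have := jmin j0; move/asboolP in pj0; rewrite pj0 => /(_ isT) jj0.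
  by apply: leq_ltn_trans jj0 _; move: j0k; rewrite mem_iota.
have -> : \sum_(j < k) vol (pcell j) = lam ^+ n.+1 * \sum_(j < k) vol (shrunk j).
  by rewrite mulr_sumr; apply: eq_bigr => j _; exact: vol_affine.
rewrite ler_pM2l ?exprn_gt0//; apply: sum_vol_le.
- exact: ballsU_lty.
- by move=> j jk; apply: leb_measurable_affine => //; exact: measurable_pcell.
- move=> j jk y [[h _] _]; exists (nth (0, 1) m j); first exact: mem_nth.
  apply/eballE; first exact: rad0.
  move: h; rewrite /power subr_lt0 /shift.
  have -> : lam *: y + (1 - lam) *: ctr j - ctr j = lam *: (y - ctr j).
    by rewrite scalerBl scale1r scalerBr addrCA addrAC subrr add0r.
  by rewrite esqZ exprMn ltr_pM2l ?exprn_gt0.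
- exact: shrunk_disjoint.
Qed.

End power_cells.

End dilated_balls.

(** * Dyadic cells and densities on their unions *)

Lemma floor_double_eq (R : realType) (a b : R) :
  Num.floor (2 * a) = Num.floor (2 * b) -> Num.floor a = Num.floor b.
Proof.
move=> ab; apply/esym/Num.Theory.floor_def.
have /andP[a1 a2] := Num.Theory.floor_itv a.
have /andP[b1 b2] := Num.Theory.floor_itv (2 * b).
move: a1 a2; set z := Num.floor a => a1 a2.
have h1 : 2 * z <= Num.floor (2 * b).
  by rewrite -ab Num.Theory.floor_ge_int intrM ler_pM2l.
have h2 : Num.floor (2 * b) < 2 * (z + 1).
  by rewrite -ab Num.Theory.floor_lt_int intrM ltr_pM2l.
have h3 : (2 * z)%:~R <= 2 * b by apply: le_trans b1; rewrite ler_int.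
have h4 : 2 * b < (2 * (z + 1))%:~R.
  by apply: (lt_le_trans b2); rewrite ler_int lezD1.
by move: h3 h4; rewrite !intrM ler_pM2l// ltr_pM2l// => -> ->.
Qed.

Section dyadic.
Context {R : realType} {n : nat}.
Notation V := 'rV[R]_n.+1.
Implicit Types (A E G : set V) (c x y : V) (r s : R) (m : seq (V * R)).

Lemma cell_half s x y : 0 < s -> cell (s / 2) x = cell (s / 2) y -> cell s x = cell s y.
Proof.
move=> s0 xy; apply/rowP => i; rewrite !mxE; apply: floor_double_eq.
have := congr1 (fun z : 'rV[int]_n.+1 => z ord0 i) xy; rewrite !mxE.
by rewrite !invf_div !(mulrCA _ 2).
Qed.

Lemma cell_pow s x y k l : 0 < s -> (k <= l)%N ->
  cell (s / 2 ^+ l) x = cell (s / 2 ^+ l) y -> cell (s / 2 ^+ k) x = cell (s / 2 ^+ k) y.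
Proof.
move=> s0 /subnK <-; elim: (l - k)%N => // j IH h; apply: IH.
apply: cell_half; first by rewrite divr_gt0// exprn_gt0.
by move: h; rewrite addSn exprSr invfM mulrA.
Qed.

Definition saturated s A := forall x y, cell s x = cell s y -> A x -> A y.

Lemma leb_measurable_saturated s A : 0 < s -> saturated s A -> leb_measurable A.
Proof.
move=> s0 satA.
have -> : A = \bigcup_z (if pselect (cellset s z `<=` A) then cellset s z else set0).
  apply/seteqP; split => [x Ax|x [z _]]; last by case: pselect => // h /h.
  exists (cell s x) => //; case: pselect => // -[] y /= yx.
  by apply: satA Ax; rewrite yx.
apply: leb_measurable_countable => z; case: pselect => _ /=.
  exact: leb_measurable_cellset.
exact: leb_measurable0.
Qed.

Lemma saturated_density s A E (eta : R) : 0 < s -> saturated s A -> 0 <= eta ->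
  (leb_outer A < +oo)%E ->
  (forall x, A x -> vol (cellset s (cell s x) `\` E) <= eta * s ^+ n.+1) ->
  vol (A `\` E) <= eta * vol A.
Proof.
move=> s0 satA eta0 Aoo AE.
pose F k := if pickle_inv k is Some z then cellset s z else (set0 : set V).
have mF k : leb_measurable (F k).
  rewrite /F; case: pickle_inv => [z|]; last exact: leb_measurable0.
  exact: leb_measurable_cellset.
have Fpickle i x : F i x -> i = pickle (cell s x).
  rewrite /F; have := @pickle_invK 'rV[int]_n.+1 i.
  by case: pickle_inv => //= z <- ->.
have tF : trivIset setT F.
  apply/trivIsetP => i j _ _ /eqP ij; apply/seteqP; split => // x [Fi Fj].
  by apply: ij; rewrite (Fpickle _ _ Fi) (Fpickle _ _ Fj).
have sumF : (\sum_(k <oo) leb_outer (A `&` F k) <= leb_outer A)%E.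
  apply: le_trans (@caratheodory_lime_le _ _ (@leb_outer R n.+1) F mF tF A).
  by rewrite leeDl// leb_outer_ge0.
have Aoo' : (leb_outer (A `\` E) < +oo)%E by apply: leb_sub_lty Aoo => x [].
rewrite -lee_fin EFinM -!volE//.
apply: (@le_trans _ _ (\sum_(k <oo) leb_outer ((A `&` F k) `\` E))%E).
  apply: le_trans (leb_outer_sigma_subadditive _); apply: le_leb_outer => x [Ax nE].
  exists (pickle (cell s x)) => //; split => //; split => //.
  by rewrite /F pickleK_inv.
apply: (@le_trans _ _ (\sum_(k <oo) (eta%:E * leb_outer (A `&` F k)))%E); last first.
  rewrite nneseriesZl; last by move=> k _; exact: leb_outer_ge0.
  by apply: lee_wpmul2l => //; rewrite lee_fin.
apply: lee_nneseries => k *; first exact: leb_outer_ge0.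
have [[x [Ax Fx]]|/forallNP AF] := pselect (A `&` F k !=set0); last first.
  rewrite (_ : A `&` F k = set0) ?set0D ?leb_outer0 ?mule0//.
  by apply/seteqP; split => // x /AF.
have Fk : F k = cellset s (cell s x) by rewrite (Fpickle _ _ Fx) /F pickleK_inv.
rewrite Fk setIidr; last by move=> y /= yx; apply: satA Ax; rewrite yx.
rewrite leb_outer_cellset// -EFinM volE ?lee_fin; first exact: AE.
by apply: (@leb_sub_lty _ _ _ (cellset s (cell s x))) => [y []//|]; rewrite leb_outer_cellset// ltry.
Qed.

Section inner_cells.
Variables (s0 : R) (lev : V * R -> nat).
Hypothesis s0_gt0 : 0 < s0.

Let side (p : V * R) := s0 / 2 ^+ lev p.
Let side_gt0 p : 0 < side p. Proof. by rewrite divr_gt0// exprn_gt0. Qed.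

(** The union of those dyadic cells, at the level assigned to the ball, that lie inside it. *)
Definition inner (p : V * R) : set V :=
  [set x | cellset (side p) (cell (side p) x) `<=` eball p.1 p.2].

Let inner_sub p : inner p `<=` eball p.1 p.2.
Proof. by move=> x; apply. Qed.

Let saturated_inner p : saturated (side p) (inner p).
Proof. by move=> x y xy; rewrite /inner /= xy. Qed.

Let innerU m : set V := \bigcup_(p in [set` m]) inner p.

Let innerU_lty m : posballs m -> (leb_outer (innerU m) < +oo)%E.
Proof.
move=> posm; apply: leb_sub_lty (ballsU_lty posm) => x [p pm px].
by exists p => //; exact: inner_sub.
Qed.

Let measurable_innerU m : leb_measurable (innerU m).
Proof.
elim: m => [|p m IH].
  rewrite (_ : innerU [::] = set0); first exact: leb_measurable0.
  by apply/seteqP; split => // x [q].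
rewrite (_ : innerU (p :: m) = inner p `|` innerU m).
  apply: leb_measurableU IH.
  exact: leb_measurable_saturated (side_gt0 p) (@saturated_inner p).
apply/seteqP; split => [x [q /=]|x [px|[q qm qx]]].
- by rewrite inE => /orP[/eqP ->|qm]; [left|right; exists q].
- by exists p => //=; rewrite mem_head.
- by exists q => //=; rewrite inE orbC qm.
Qed.

(** Induction removes a ball of the finest level. What it adds to the other inner sets is still a
    union of its own cells, as coarser cells are unions of finer ones, so the density bound applies
    to the added part cell by cell. *)
Lemma inner_density m E (eta : R) : posballs m -> 0 <= eta ->
  (forall p x, p \in m -> inner p x ->
     vol (cellset (side p) (cell (side p) x) `\` E) <= eta * side p ^+ n.+1) ->
  vol (innerU m `\` E) <= eta * vol (innerU m).
Proof.
move=> + eta0; have [k] := ubnP (size m); elim: k m => // k IH m; rewrite ltnS => mk posm mE.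
have [->|m0] := eqVneq m [::].
  rewrite (_ : innerU [::] = set0) ?set0D ?vol0 ?mulr0//.
  by apply/seteqP; split => // x [q].
have [p pm pmax] := exists_maximal (fun q => (lev q)%:R : R) m0.
pose m' := [seq q <- m | q != p].
have m'm : {subset m' <= m} by move=> q; rewrite mem_filter => /andP[].
have posm' : posballs m' by move=> q /m'm/posm.
pose A := inner p `\` innerU m'.
have mUA : innerU m = innerU m' `|` A.
  apply/seteqP; split => [x [q qm qx]|x [[q /m'm qm qx]|[px _]]].
  - have [?|nx] := pselect (innerU m' x); [by left|right; split => //].
    have [qp|qp] := eqVneq q p; first by rewrite -qp.
    by exfalso; apply: nx; exists q => //=; rewrite mem_filter qp.
  - by exists q.
  - by exists p.
have satA : saturated (side p) A.
  move=> x y xy [px nx]; split; first exact: saturated_inner xy px.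
  move=> [q qm' qy]; apply: nx; exists q => //.
  apply: saturated_inner qy; apply: cell_pow (esym xy) => //.
  by have := pmax q (m'm _ qm'); rewrite ler_nat.
have mA := leb_measurable_saturated (side_gt0 p) satA.
have Aoo : (leb_outer A < +oo)%E.
  by apply: (leb_sub_lty _ (innerU_lty posm)) => x Ax; rewrite mUA; right.
have Uoo := innerU_lty posm'.
rewrite mUA volU//; last by move=> x [xm' []].
rewrite mulrDr setDUl; apply: (le_trans (volU_le _ _)).
- by apply: leb_sub_lty Uoo => x [].
- by apply: leb_sub_lty Aoo => x [].
- apply: lerD.
    apply: IH => // [|q x /m'm]; last exact: mE.
    by apply: leq_trans mk; apply: size_filter_lt pm _; rewrite eqxx.
  apply: saturated_density (side_gt0 p) satA eta0 Aoo _ => x [px _].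
  exact: mE.
Qed.

Lemma inner_vol_le m E (eta : R) : posballs m -> 0 <= eta -> (leb_outer E < +oo)%E ->
  (forall p x, p \in m -> inner p x ->
     vol (cellset (side p) (cell (side p) x) `\` E) <= eta * side p ^+ n.+1) ->
  (1 - eta) * vol (\bigcup_(p in [set` m]) inner p) <= vol E.
Proof.
move=> posm eta0 Eoo mE; rewrite -/(innerU m).
have Uoo := innerU_lty posm.
have h1 := inner_density posm eta0 mE.
have h2 : vol (innerU m) <= vol (innerU m `&` E) + vol (innerU m `\` E).
  rewrite -{1}(setUIDK (innerU m) E).
  by apply: volU_le; apply: leb_sub_lty Uoo => x [].
have h3 : vol (innerU m `&` E) <= vol E by apply: le_vol => // x [].
by rewrite mulrBl mul1r; lra.
Qed.

End inner_cells.

(** The least level whose side is at most [a]; at level 0 the upper bound comes from [a <= s0]. *)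
Lemma exists_level (s0 a : R) : 0 < a -> a <= s0 ->
  exists k, s0 / 2 ^+ k <= a < 2 * (s0 / 2 ^+ k).
Proof.
move=> a0 as0; have s00 : 0 < s0 by exact: lt_le_trans as0.
have ex : exists k, s0 / 2 ^+ k <= a.
  exists (Num.truncn (s0 / a)).+1; rewrite ler_pdivrMr ?exprn_gt0// mulrC -ler_pdivrMr//.
  apply: ltW; apply: (lt_trans (Num.Theory.truncnS_gt _)).
  by rewrite -natrX ltr_nat ltn_expl.
have [k kP kmin] := ex_minnP ex; exists k; rewrite kP /=.
case: k kP kmin => [_ _|k _ kmin]; first by rewrite expr0 divr1; lra.
rewrite ltNge; apply/negP => h; suff : (k < k)%N by rewrite ltnn.
by apply: kmin; apply: le_trans h; rewrite exprS invfM mulrCA (mulrA 2) mulfV ?mul1r.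
Qed.

End dyadic.

Lemma bernoulli_le (R : realFieldType) (e : R) k : 0 <= e <= 1 ->
  1 - k%:R * e <= (1 - e) ^+ k.
Proof.
move=> /andP[e0 e1]; elim: k => [|k IH]; first by rewrite mul0r subr0 expr0.
rewrite exprS (le_trans _ (ler_wpM2l _ IH)) ?subr_ge0//.
have : 0 <= k%:R * e * e by rewrite !mulr_ge0.
by rewrite -natr1; nra.
Qed.

(** * The Tauberian constant near level 1 *)

Section solyanik.
Context {R : realType} {n : nat}.
Notation V := 'rV[R]_n.+1.
Notation C := (@C_HL_b R n.+1).
Implicit Types (G : set V) (al be eps eta : R) (m : seq (V * R)).

(** A ball has at most [kap / eps ^+ n.+1] times the volume of one of its cells. *)
Let kap : R := vol (eball (0 : V) 1) * (2 * n.+1%:R) ^+ n.+1.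

(** There are two losses: shrinking the balls costs the factor (1 - eps)^(n+1), and passing from
    density on balls to density on cells turns [eta] into kap eta / eps^(n+1). *)
Lemma solyanik_balls G m eps eta : (leb_outer G < +oo)%E -> eopen G ->
  0 < eps < 1 -> 0 <= eta -> (forall p, p \in m -> dense_balls (1 - eta) G p) ->
  0 <= 1 - kap * eta / eps ^+ n.+1 ->
  (1 - eps) ^+ n.+1 * (1 - kap * eta / eps ^+ n.+1) * vol (ballsU m) <= vol G.
Proof.
move=> Goo oG /andP[eps0 eps1] eta0 mG eta'1; set eta' := kap * eta / eps ^+ n.+1.
have posm := posballs_dense_balls mG.
have [->|m0] := eqVneq m [::]; first by rewrite ballsU_nil vol0 mulr0 vol_ge0.
have [pM pMm pMmax] := exists_maximal snd m0.
(* A cell of side at most [a p] has diameter at most [eps * p.2], so any cell that meets the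
   shrunken ball stays in the original one. The side for the largest ball starts the dyadic
   scale. *)
pose a (p : V * R) := eps * p.2 / n.+1%:R.
have a_gt0 p : p \in m -> 0 < a p by move=> /posm p0; rewrite divr_gt0// mulr_gt0.
pose s0 := a pM; have s00 : 0 < s0 by exact: a_gt0.
have /choice[lev levP] : forall p, exists k, p \in m ->
    s0 / 2 ^+ k <= a p < 2 * (s0 / 2 ^+ k).
  move=> p; have [pm|] := boolP (p \in m); last by exists 0%N.
  have [|k kP] := @exists_level R s0 (a p) (a_gt0 _ pm); last by exists k.
  by rewrite /s0 /a ler_wpM2r ?invr_ge0// ler_wpM2l ?(ltW eps0)//; exact: pMmax.
have one_eps : 0 < 1 - eps by rewrite subr_gt0.
pose m' := [seq (p.1, (1 - eps) * p.2) | p <- m].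
have posm' : posballs m'.
  by move=> _ /mapP[p pm ->] /=; rewrite mulr_gt0//; exact: posm.
(* The original family is the dilation of the shrunken one, so [vol_dilated_balls] bounds the
   loss. *)
have mm' : [seq (p.1, (1 - eps)^-1 * p.2) | p <- m'] = m.
  rewrite -map_comp -[RHS]map_id; apply: eq_map => -[c r] /=.
  by rewrite mulrA mulVf ?gt_eqF// mul1r.
have h1 : (1 - eps) ^+ n.+1 * vol (ballsU m) <= vol (ballsU m').
  rewrite -ler_pdivlMl ?exprn_gt0// -exprVn -{1}mm'.
  by apply: vol_dilated_balls => //; rewrite invf_gt1// ltrBlDr ltrDl.
pose W := \bigcup_(p in [set` m]) inner s0 lev p.
have Woo : (leb_outer W < +oo)%E.
  apply: (leb_sub_lty _ (ballsU_lty posm)) => x [p pm px]; exists p => //; exact: px.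
have h2 : vol (ballsU m') <= vol W.
  apply: le_vol => // x [_ /= /mapP[p pm ->] /= px]; exists p => // y /= yx.
  have p0 := posm _ pm.
  have -> : p.2 = (1 - eps) * p.2 + eps * p.2 by ring.
  have ep0 : 0 < eps * p.2 by rewrite mulr_gt0.
  apply: (eballD _ ep0 px); first by rewrite mulr_gt0.
  have sp0 : 0 < s0 / 2 ^+ lev p by rewrite divr_gt0// exprn_gt0.
  apply: (@le_trans _ _ ((n.+1%:R * (s0 / 2 ^+ lev p)) ^+ 2)).
    apply: esq_coord_le; first exact: ltW.
    by move=> i; rewrite !mxE; apply: cell_dist.
  have nsp0 : 0 <= n.+1%:R * (s0 / 2 ^+ lev p) by rewrite mulr_ge0// ltW.
  rewrite ler_sqr ?nnegrE ?(ltW ep0)//.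
  by rewrite mulrC -ler_pdivlMr//; have /andP[] := levP _ pm.
have h3 : (1 - eta') * vol W <= vol G.
  apply: inner_vol_le => //.
    by rewrite /eta' divr_ge0 ?mulr_ge0 ?vol_ge0 ?exprn_ge0 ?(ltW eps0)// mulr_ge0.
  move=> p x pm px; have [p0 hp] := mG _ pm.
  set s := s0 / 2 ^+ lev p; set B := eball p.1 p.2 in hp *.
  have s_gt0 : 0 < s by rewrite divr_gt0// exprn_gt0.
  have Boo : (leb_outer B < +oo)%E by exact: eball_lty.
  have BG : vol (B `\` G) <= eta * vol B.
    have := vol_split (leb_measurable_eopen oG) Boo; rewrite setIC.
    by move: hp => /=; rewrite -/B; lra.
  apply: (@le_trans _ _ (vol (B `\` G))).
    apply: le_vol; last by apply: (leb_sub_lty _ Boo) => y [].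
    by move=> y [ys nG]; split => //; exact: px.
  apply: (le_trans BG).
  have pr : p.2 <= 2 * n.+1%:R / eps * s.
    have /andP[_ /ltW] := levP _ pm; rewrite -/s /a ler_pdivrMr// mulrC.
    by rewrite -ler_pdivlMr// => /le_trans; apply; rewrite le_eqVlt; apply/orP; left; apply/eqP; ring.
  rewrite vol_eball//; apply: (@le_trans _ _
      (eta * ((2 * n.+1%:R / eps * s) ^+ n.+1 * vol (eball (0 : V) 1)))).
    rewrite ler_wpM2l// ler_wpM2r ?vol_ge0//.
    by rewrite lerXn2r ?nnegrE ?(ltW p0)// (le_trans _ pr)// ltW.
  rewrite !exprMn exprVn /eta' /kap exprMn le_eqVlt; apply/orP; left; apply/eqP; ring.
rewrite -mulrA mulrCA; apply: le_trans h3; rewrite ler_wpM2l//.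
exact: le_trans h1 h2.
Qed.

(** The exponent [n.+2], one above the dimension, turns the cell loss into [kap * eps]; by Bernoulli
    the shrinking loss is at most [n.+1%:R * eps], and [L] is the sum of the two slopes. *)
Lemma solyanik : exists2 L, 0 < L & forall eps, 0 < eps -> L * eps <= 2^-1 ->
  (C (1 - eps ^+ n.+2) <= (1 + 2 * L * eps)%:E)%E.
Proof.
have kap0 : 0 <= kap by rewrite mulr_ge0 ?vol_ge0 ?exprn_ge0// mulr_ge0.
exists (n.+1%:R + kap); first by rewrite ltr_wpDr.
set L := _ + _ => eps eps0 Leps.
have n1 : 1 <= n.+1%:R :> R by rewrite ler1n.
have eps1 : eps <= 2^-1.
  by apply: le_trans Leps; rewrite ler_peMl ?(ltW eps0)//; rewrite /L; lra.
have ke0 : 0 <= kap * eps by rewrite mulr_ge0// ltW.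
have ne0 : 0 <= n.+1%:R * eps by rewrite mulr_ge0// ltW.
have Leps0 : 0 <= L * eps by rewrite /L mulrDl addr_ge0.
have keE : kap * eps ^+ n.+2 / eps ^+ n.+1 = kap * eps.
  by rewrite exprS -!mulrA mulfV ?mulr1// expf_neq0// gt_eqF.
apply: C_HL_b_le => [|G m oG Goo G0 mG]; first by rewrite -mulrA; lra.
have h := @solyanik_balls G m eps (eps ^+ n.+2) Goo oG.
have := h; rewrite keE => /(_ _ _ mG _) {}h.
have ke1 : kap * eps <= 1 by move: Leps; rewrite /L mulrDl; lra.
have {h} h : (1 - eps) ^+ n.+1 * (1 - kap * eps) * vol (ballsU m) <= vol G.
  apply: h; [by rewrite eps0 /=; lra|by rewrite exprn_ge0// ltW|by rewrite subr_ge0].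
have U0 := vol_ge0 (ballsU m).
have h2 : (1 - L * eps) * vol (ballsU m) <= vol G.
  apply: le_trans h; rewrite ler_wpM2r//.
  apply: (@le_trans _ _ ((1 - n.+1%:R * eps) * (1 - kap * eps))).
    by rewrite /L mulrDl; have := mulr_ge0 ne0 ke0; lra.
  by rewrite ler_wpM2r ?subr_ge0// bernoulli_le//; apply/andP; split; lra.
apply: (@le_trans _ _ ((1 + 2 * L * eps) * ((1 - L * eps) * vol (ballsU m)))); last first.
  by rewrite ler_wpM2l//; rewrite -mulrA; lra.
rewrite mulrA -{1}(mul1r (vol _)) ler_wpM2r//.
(* Equivalent to (1 + 2 L eps) (1 - L eps) >= 1. *)
have : 0 <= (L * eps) * (2^-1 - L * eps) by rewrite mulr_ge0// subr_ge0.
by rewrite -(mulrA 2 L eps); lra.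
Qed.

End solyanik.

(** * Holder continuity *)

Lemma invSn_itv (R : realFieldType) k : 0 < (k.+1%:R^-1 : R) <= 1.
Proof. by rewrite invr_gt0 ltr0n/= invf_le1 ?ler1n ?ltr0n. Qed.

(** The common form of both local Lipschitz bounds: [u] and [w] are values of C, [d] is the
    increment, and [s] is the distance to the singularity, at least [t] on a compact set. *)
Lemma ler_mul_slope (R : realFieldType) (u w M d s t : R) :
  1 <= u <= M -> 1 <= w <= M -> 0 <= d -> 0 < t <= s ->
  u * (d / s * (w - 1)) <= M * M / t * d.
Proof.
move=> /andP[u1 uM] /andP[w1 wM] d0 /andP[t0 ts]; have s0 : 0 < s := lt_le_trans t0 ts.
have h : d / s * (w - 1) <= d / t * M.
  apply: ler_pM; [by rewrite divr_ge0// ltW|by rewrite subr_ge0| |lra].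
  by rewrite ler_wpM2l// lef_pV2.
have -> : M * M / t * d = M * (d / t * M) by ring.
apply: ler_pM => //; first lra.
by rewrite mulr_ge0 ?subr_ge0// divr_ge0// ltW.
Qed.

(** * From Lipschitz to Holder bounds on compact sets *)

Section compact_subsets.
Context {R : realType}.
Implicit Types (K : set R) (u D p : R).

Lemma compact_itv K x0 : compact K -> K x0 ->
  exists a b, [/\ K a, K b & forall x, K x -> a <= x <= b].
Proof.
move=> cK Kx0.
have idc : {within K, continuous (@id R)} by apply: continuous_subspaceT => x; exact: cvg_id.
have K0 : K !=set0 by exists x0.
have [b /set_mem Kb bmax] := compact_EVT_max K0 cK idc.
have [a /set_mem Ka amin] := compact_EVT_min K0 cK idc.
by exists a, b; split => // x Kx; rewrite amin ?bmax ?inE.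
Qed.

Lemma le_powR_bounded u D p : 0 <= u <= D -> 1 <= D -> 0 < p <= 1 -> u <= D * u `^ p.
Proof.
move=> /andP[u0 uD] D1 /andP[p0 p1].
have [->|un0] := eqVneq u 0; first by rewrite powR0 ?mulr0// gt_eqF.
have ugt0 : 0 < u by rewrite lt_def un0.
have [u1|u1] := leP u 1.
  apply: (@le_trans _ _ (u `^ p)); first by apply: ger1_powR => //; rewrite ugt0.
  by rewrite ler_peMl// powR_ge0.
apply: (le_trans uD); rewrite ler_peMr ?(le_trans _ D1)//.
by rewrite -(powRr0 u) ler_powR ?ltW.
Qed.

Lemma holder_lipschitz K (f : R -> R) p M : compact K -> 0 < p <= 1 -> 0 <= M ->
  (forall x y, K x -> K y -> x < y -> `|f x - f y| <= M * (y - x)) ->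
  exists CK, forall x y, K x -> K y -> `|f x - f y| <= CK * `|x - y| `^ p.
Proof.
move=> cK p01 M0 fM.
have [[x0 Kx0]|/forallNP K0] := pselect (K !=set0); last by exists 0 => x y /K0.
have [a [b [Ka Kb Kab]]] := compact_itv cK Kx0.
have ab : a <= b by have /andP[] := Kab _ Kb.
have key x y : K x -> K y -> x < y ->
    (* The summand 1 makes the factor at least 1, as [le_powR_bounded] requires. *)
    `|f x - f y| <= M * (b - a + 1) * `|x - y| `^ p.
  move=> Kx Ky xy; apply: (le_trans (fM x y Kx Ky xy)); rewrite -mulrA ler_wpM2l//.
  rewrite distrC gtr0_norm ?subr_gt0//; apply: le_powR_bounded => //; last by lra.
  by have := Kab _ Kx; have := Kab _ Ky; lra.
exists (M * (b - a + 1)) => x y Kx Ky.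
have [xy|yx|->] := ltgtP x y; first exact: key.
  by rewrite distrC [X in X `^ _]distrC; exact: key.
by rewrite !subrr normr0 mulr_ge0 ?powR_ge0// mulr_ge0//; lra.
Qed.

End compact_subsets.

(** * Holder bounds for the Tauberian constant and the halo function *)

Section halo.
Context {R : realType} {n : nat}.
Notation C := (@C_HL_b R n.+1).
Implicit Types (al be a b x y : R).

Let c al : R := fine (C al).

Lemma C_HL_b_fin_num al : 0 < al -> C al \is a fin_num.
Proof.
move=> al0; rewrite ge0_fin_numE ?C_HL_b_ge0//.
by rewrite (le_lt_trans (C_HL_b_weak_type al0))// ltry.
Qed.

Let C_le_c al : 0 < al -> (C al <= (c al)%:E)%E.
Proof. by move=> al0; rewrite fineK// C_HL_b_fin_num. Qed.

Let c_le al K : 0 < al -> (C al <= K%:E)%E -> c al <= K.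
Proof. by move=> al0 CK; rewrite -lee_fin fineK// C_HL_b_fin_num. Qed.

Let c_ge1 al : 0 < al -> al < 1 -> 1 <= c al.
Proof. by move=> al0 al1; apply: (C_HL_b_ge1 al1); exact: C_le_c. Qed.

Let c_homo al be : 0 < al -> al <= be -> c be <= c al.
Proof.
move=> al0 ab; apply: c_le; first exact: lt_le_trans ab.
exact: le_trans (C_HL_b_nonincreasing ab) (C_le_c al0).
Qed.

Let c_diff be al : 0 < be -> be < al -> al < 1 ->
  c be - c al <= c al * ((al - be) / (1 - be) * (c be - 1)).
Proof.
move=> be0 ba a1; have al0 := lt_trans be0 ba.
have := c_le be0 (C_HL_b_compare ba a1 (C_le_c be0) (C_le_c al0)).
by rewrite mulrDr mulr1; lra.
Qed.

(** Extends the Solyanik bound to all levels in [b, 1). If [L * eps] exceeds 1/2, then [2 * L * eps]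
    is above 1 and monotonicity of C suffices. *)
Lemma solyanik_powR b : 0 < b -> b < 1 -> exists2 K, 0 <= K &
  forall al, b <= al -> al < 1 -> c al - 1 <= K * (1 - al) `^ (n.+2%:R)^-1.
Proof.
move=> b0 b1; have [L L0 hL] := @solyanik R n.
have cb1 := c_ge1 b0 b1.
exists (2 * L * (1 + c b)); first by rewrite !mulr_ge0 ?(ltW L0)//; lra.
move=> al bal al1; have al0 := lt_le_trans b0 bal.
set eps := _ `^ _.
have eps0 : 0 < eps by rewrite powR_gt0// subr_gt0.
have epsE : eps ^+ n.+2 = 1 - al.
  rewrite /eps -powR_mulrn ?powR_ge0// -powRrM mulVf// powRr1//.
  by rewrite subr_ge0 ltW.
have Le0 : 0 < L * eps by rewrite mulr_gt0.
have [h|h] := leP (L * eps) 2^-1.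
  have := hL _ eps0 h; rewrite epsE subKr => /(c_le al0) h1.
  apply: (@le_trans _ _ (2 * L * eps)); first by lra.
  rewrite ler_wpM2r ?(ltW eps0)// ler_peMr ?mulr_ge0 ?(ltW L0)//; lra.
apply: (@le_trans _ _ (1 + c b)); first by have := c_homo b0 bal; lra.
rewrite mulrAC ler_peMl//; first by lra.
by rewrite -mulrA; lra.
Qed.

Lemma holder_C_HL_b :
  holder_on (n.+1%:R)^-1 [set a : R | 0 < a < 1] (fun a => fine (C a)).
Proof.
move=> K cK K01.
have p01 := invSn_itv R n.
have [[x0 Kx0]|/forallNP K0] := pselect (K !=set0); last by exists 0 => x y /K0.
have [a [b [/K01/andP[a0 a1] /K01/andP[b0 b1] Kab]]] := compact_itv cK Kx0.
have ca1 := c_ge1 a0 a1.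
have b1' : 0 < 1 - b by rewrite subr_gt0.
apply: (@holder_lipschitz _ K _ _ (c a * c a / (1 - b)) cK p01).
  by rewrite divr_ge0 ?(ltW b1')// mulr_ge0 ?(le_trans _ ca1).
move=> x y Kx Ky xy.
have /andP[x_gt0 x_lt1] := K01 _ Kx; have /andP[y_gt0 y_lt1] := K01 _ Ky.
have /andP[ax xb] := Kab _ Kx; have /andP[ay yb] := Kab _ Ky.
rewrite ger0_norm ?subr_ge0; last exact: c_homo x_gt0 (ltW xy).
apply: (le_trans (c_diff x_gt0 xy y_lt1)).
have cx : 1 <= c x <= c a by apply/andP; split; [exact: c_ge1|exact: c_homo].
have cy : 1 <= c y <= c a by apply/andP; split; [exact: c_ge1|exact: c_homo].
apply: ler_mul_slope cy cx _ _; first by rewrite subr_ge0 ltW.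
by rewrite b1' lerB.
Qed.

Lemma phi_HL_b_gt1 x : 1 < x -> phi_HL_b n.+1 x = c x^-1.
Proof. by move=> x1; rewrite /phi_HL_b leNgt x1. Qed.

Lemma phi_HL_b_diff x y : 1 < x -> x < y ->
  0 <= phi_HL_b n.+1 y - phi_HL_b n.+1 x <=
    c y^-1 * ((y - x) / (y - 1) * (c y^-1 - 1)).
Proof.
move=> x1 xy; have y1 := lt_trans x1 xy.
have x0 : 0 < x by exact: lt_trans x1.
have y0 : 0 < y by exact: lt_trans y1.
have xi : x^-1 < 1 by rewrite invf_lt1.
have yi : y^-1 < 1 by rewrite invf_lt1.
have yx : y^-1 < x^-1 by rewrite ltf_pV2.
have xi0 : 0 < x^-1 by rewrite invr_gt0.
have yi0 : 0 < y^-1 by rewrite invr_gt0.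
have cyx := c_homo yi0 (ltW yx); have cx := c_ge1 xi0 xi; have cy := c_ge1 yi0 yi.
rewrite !phi_HL_b_gt1// subr_ge0 cyx /=.
apply: (le_trans (c_diff yi0 yx xi)).
have cx0 : 0 <= c x^-1 := le_trans ler01 cx.
have cy0 : 0 <= c y^-1 - 1 by rewrite subr_ge0.
(* In the variables 1/x and 1/y the slope gains only a factor 1/x < 1. *)
suff h : (x^-1 - y^-1) / (1 - y^-1) <= (y - x) / (y - 1).
  refine (ler_pM cx0 _ cyx (ler_wpM2r cy0 h)).
  by apply: mulr_ge0 cy0; rewrite divr_ge0 ?subr_ge0// ltW.
have -> : (x^-1 - y^-1) / (1 - y^-1) = x^-1 * ((y - x) / (y - 1)).
  by field; rewrite !gt_eqF ?subr_gt0.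
rewrite ler_piMl ?(ltW xi)// divr_ge0 ?subr_ge0 ?(ltW xy) ?(ltW y1)//.
Qed.

Lemma holder_phi_HL_b_gt1 :
  holder_on (n.+1%:R)^-1 [set a : R | 1 < a] (@phi_HL_b R n.+1).
Proof.
move=> K cK K1.
have p01 := invSn_itv R n.
have [[x0 Kx0]|/forallNP K0] := pselect (K !=set0); last by exists 0 => x y /K0.
have [a [b [/K1/= a1 /K1/= b1 Kab]]] := compact_itv cK Kx0.
have b0 : 0 < b by exact: lt_trans b1.
have bi0 : 0 < b^-1 by rewrite invr_gt0.
have cb1 : 1 <= c b^-1 by apply: c_ge1 => //; rewrite invf_lt1.
have a1' : 0 < a - 1 by rewrite subr_gt0.
apply: (@holder_lipschitz _ K _ _ (c b^-1 * c b^-1 / (a - 1)) cK p01).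
  by rewrite divr_ge0 ?(ltW a1')// mulr_ge0 ?(le_trans _ cb1).
move=> x y Kx Ky xy.
have x1 : 1 < x by exact: K1.
have y1 : 1 < y by exact: K1.
have /andP[ax xb] := Kab _ Kx; have /andP[ay yb] := Kab _ Ky.
have y0 : 0 < y by exact: lt_trans y1.
have /andP[h0 h1] := phi_HL_b_diff x1 xy.
have cy : 1 <= c y^-1 by apply: c_ge1; rewrite ?invr_gt0// invf_lt1.
have cyb : c y^-1 <= c b^-1 by apply: c_homo => //; rewrite lef_pV2.
rewrite distrC ger0_norm//; apply: (le_trans h1).
have cyM : 1 <= c y^-1 <= c b^-1 by apply/andP.
apply: (ler_mul_slope cyM cyM); first by rewrite subr_ge0 ltW.
by rewrite a1' lerB.
Qed.

Lemma holder_phi_HL_b :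
  holder_on (n.+2%:R)^-1 [set a : R | 0 <= a] (@phi_HL_b R n.+1).
Proof.
move=> K cK K0.
set p : R := (n.+2%:R)^-1.
have p01 : 0 < p <= 1 := invSn_itv R n.+1.
have /andP[p0 p1] := p01.
have [[x0 Kx0]|/forallNP Kn] := pselect (K !=set0); last by exists 0 => x y /Kn.
have [a [b' [_ _ Kab]]] := compact_itv cK Kx0.
(* The maximum with 2 ensures 1/b < 1, so that the value of C at 1/b and the Solyanik bound apply
   uniformly. *)
pose b := Num.max b' 2.
have b2 : 2 <= b by rewrite le_max lexx orbT.
have b0 : 0 < b by lra.
have bi0 : 0 < b^-1 by rewrite invr_gt0.
have bi1 : b^-1 < 1 by rewrite invf_lt1//; lra.
have Kb x : K x -> 0 <= x <= b.
  move=> Kx; have := K0 _ Kx => /= ->; rewrite le_max.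
  by have /andP[_ ->] := Kab _ Kx.
have [K1 K1_ge0 hK1] := solyanik_powR bi0 bi1.
have M1 := c_ge1 bi0 bi1; set M := c b^-1 in M1.
have cM y : 1 < y -> y <= b -> 1 <= c y^-1 <= M.
  move=> y1 yb; have y0 : 0 < y by lra.
  rewrite c_ge1 ?invr_gt0 ?invf_lt1//=; apply: c_homo => //; by rewrite lef_pV2.
have solK y : 1 < y -> y <= b -> c y^-1 - 1 <= K1 * (y - 1) `^ p.
  move=> y1 yb; have y0 : 0 < y by lra.
  apply: (le_trans (hK1 y^-1 _ _)); rewrite ?lef_pV2 ?invf_lt1//.
  rewrite ler_wpM2l// ge0_ler_powR ?(ltW p0)// ?nnegrE ?subr_ge0 ?(ltW y1)//.
    by rewrite invf_le1 ?(ltW y1).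
  have -> : 1 - y^-1 = y^-1 * (y - 1) by rewrite mulrBr mulr1 mulVf ?gt_eqF.
  by rewrite ler_piMl ?subr_ge0 ?(ltW y1)// invf_le1 ?(ltW y1).
(* One constant for the three positions of 1: [b] when y <= 1, [K1 + b] when x <= 1 < y, and
   [M * K1] when 1 < x. *)
pose CK := M * K1 + K1 + b.
have MK1 : 0 <= M * K1 by rewrite mulr_ge0//; lra.
have key x y : K x -> K y -> x < y ->
    `|phi_HL_b n.+1 x - phi_HL_b n.+1 y| <= CK * `|x - y| `^ p.
  move=> Kx Ky xy; have /andP[x0' xb] := Kb _ Kx; have /andP[y0' yb] := Kb _ Ky.
  rewrite distrC (distrC x) (gtr0_norm (_ : 0 < y - x)) ?subr_gt0//.
  set u := y - x.
  have u0 : 0 < u by rewrite subr_gt0.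
  have up0 : 0 <= u `^ p by exact: powR_ge0.
  have ubp : u <= b * u `^ p.
    by apply: le_powR_bounded => //; [rewrite /u; apply/andP; split; lra|lra].
  have MKu : 0 <= M * K1 * u `^ p by rewrite mulr_ge0.
  have Ku : 0 <= K1 * u `^ p by rewrite mulr_ge0.
  have CKE : CK * u `^ p = M * K1 * u `^ p + K1 * u `^ p + b * u `^ p.
    by rewrite /CK !mulrDl.
  rewrite CKE; have [y1|y1] := leP y 1.
    have x1 : x <= 1 by lra.
    by rewrite /phi_HL_b y1 x1 -/u gtr0_norm//; lra.
  have /andP[c1 cM'] := cM y y1 yb.
  have ym1 : 0 < y - 1 by lra.
  (* Across 1 the increment splits as (C(1/y) - 1) + (1 - x), the first term being a Solyanik term
     and the second at most [u]. *)
  have [x1|x1] := leP x 1.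
    rewrite (phi_HL_b_gt1 y1) /phi_HL_b x1 ger0_norm; last by lra.
    have h1 := solK y y1 yb.
    have yu : K1 * (y - 1) `^ p <= K1 * u `^ p.
      rewrite ler_wpM2l// ge0_ler_powR ?(ltW p0)// ?nnegrE ?(ltW u0) ?(ltW ym1)//.
      by rewrite /u; lra.
    have xu : 1 - x <= u by rewrite /u; lra.
    by lra.
  have /andP[h0 h1] := phi_HL_b_diff x1 xy; rewrite -/u in h1.
  rewrite ger0_norm//; apply: (le_trans h1).
  suff h : u / (y - 1) * (c y^-1 - 1) <= K1 * u `^ p.
    apply: (@le_trans _ _ (M * (K1 * u `^ p))); last by rewrite mulrA; lra.
    have c0 : 0 <= c y^-1 := le_trans ler01 c1.
    have cy0 : 0 <= c y^-1 - 1 by rewrite subr_ge0.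
    refine (ler_pM c0 _ cM' h).
    by apply: mulr_ge0 cy0; rewrite divr_ge0 ?ltW.
  (* As x > 1, [v] is at most 1 and hence at most v^p; multiplying by C(1/y) - 1 <= K1 (y - 1)^p
     cancels the denominator and leaves K1 u^p. *)
  pose v := u / (y - 1).
  have v0 : 0 < v by rewrite divr_gt0.
  have v1 : v <= 1 by rewrite ler_pdivrMr// mul1r /u; lra.
  have -> : u `^ p = v `^ p * (y - 1) `^ p.
    by rewrite -powRM ?(ltW v0) ?(ltW ym1)// divfK ?gt_eqF.
  rewrite mulrCA; apply: ler_pM; rewrite ?(ltW v0) ?subr_ge0//; last exact: solK.
  by apply: ger1_powR => //; rewrite v0.
exists CK => x y Kx Ky; have [xy|yx|->] := ltgtP x y; first exact: key.
  by rewrite distrC [X in X `^ _]distrC; exact: key.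
rewrite !subrr normr0 mulr_ge0 ?powR_ge0// /CK; lra.
Qed.

End halo.

Theorem theorem3 (R : realType) (n : nat) (hn : (0 < n)%N) :
  [/\ holder_on (n.+1%:R)^-1 [set a : R | 0 <= a] (phi_HL_b n),
      (forall alpha : R, 0 < alpha < 1 -> C_HL_b n alpha \is a fin_num)
      /\ holder_on (n%:R)^-1 [set a : R | 0 < a < 1] (fun a => fine (C_HL_b n a))
    & holder_on (n%:R)^-1 [set a : R | 1 < a] (phi_HL_b n)].
Proof.
case: n hn => // n _; split.
- exact: holder_phi_HL_b.
- split; last exact: holder_C_HL_b.
  by move=> al /andP[al0 _]; exact: C_HL_b_fin_num.
- exact: holder_phi_HL_b_gt1.
Qed.
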